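(* Let $\varepsilon>0$, $\delta>0$ and $\zeta\in(0,1/2]$. There exists an $(\varepsilon,\delta)$-DP (event-level) continual mechanism for the vector version of incremental monotone symmetric norm estimation on $n$ elements and streams of length $T$ such that for each fixed time step $t$, with probability at least $2/3$, its output $E^t\in\mathbb R^n$ satisfies, simultaneously for all monotone symmetric norms $L$, $$(1+\zeta)^{-1}L(f^t)-\alpha\cdot L(e_1)\le L(E^t)\le(1+\zeta)L(f^t)+\alpha\cdot L(e_1),\qquad \alpha=\tilde O\Big(\frac{\log^{2.5}(T)\,\log^{0.5}(nT)\,\log(1/\delta)}{\varepsilon^2\zeta^5}\Big).$$
   Context: Incremental streams over universe $[n]\cup\{\bot\}$: each update inserts one element of $[n]$ or is the empty element $\bot$; $f^t\in\mathbb N^n$ is the frequency vector after $t$ updates. A norm $L$ on $\mathbb R^n$ is monotone if $|f_i|\le|f'_i|$ for all $i$ implies $L(f)\le L(f')$, and symmetric if invariant under permutations of coordinates; $e_1=(1,0,\dots,0)$. Vector version: at each time step the mechanism outputs a vector $E^t\in\mathbb R^n$. Two streams are event-level neighboring if they differ in at most one time step; $(\varepsilon,\delta)$-DP: $\Pr[\mathcal A(u)\in S]\le e^\varepsilon\Pr[\mathcal A(v)\in S]+\delta$ for all neighbors and output sets $S$ (output = the whole sequence $E^1,\dots,E^T$). $\tilde O$ hides lower-order polylogarithmic factors (e.g. in $\log(nT)$, $\log(1/\delta)$, $1/\varepsilon$, $1/\zeta$). *)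

(* Defs.v *)
From HB Require Import structures.
From mathcomp Require Import all_boot all_order all_algebra all_fingroup.
From mathcomp Require Import all_classical all_reals all_analysis.
Set Implicit Arguments. Unset Strict Implicit. Unset Printing Implicit Defensive.
Import Order.TTheory GRing.Theory Num.Theory.
Local Open Scope classical_set_scope.
Local Open Scope ring_scope.

(* An incremental stream of length T over [n] ∪ {⊥}: update at step s
   (s : 'I_T, i.e. the (s+1)-th update) is Some i (insert i) or None (⊥). *)
Definition stream (n T : nat) := 'I_T -> option 'I_n.

(* Frequency vector after the first t+1 updates (t : 'I_T indexes the
   time steps 1..T). *)
Definition freq (R : realType) (n T : nat) (u : stream n T) (t : 'I_T) : 'rV[R]_n :=
  \row_i (#|[set s : 'I_T | (s <= t)%N && (u s == Some i)]|)%:R.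

Definition neighboring (n T : nat) (u v : stream n T) : Prop :=
  (#|[set s : 'I_T | u s != v s]| <= 1)%N.

Definition e1 (R : realType) (n : nat) : 'rV[R]_n := \row_i (if val i == 0%N then 1 else 0).

Definition is_norm (R : realType) (n : nat) (L : 'rV[R]_n -> R) : Prop :=
  [/\ forall x, 0 <= L x,
      forall x, L x = 0 -> x = 0,
      forall (a : R) x, L (a *: x) = `|a| * L x
    & forall x y, L (x + y) <= L x + L y].

Definition monotone_norm (R : realType) (n : nat) (L : 'rV[R]_n -> R) : Prop :=
  forall x y : 'rV[R]_n, (forall i, `|x ord0 i| <= `|y ord0 i|) -> L x <= L y.

Definition symmetric_norm (R : realType) (n : nat) (L : 'rV[R]_n -> R) : Prop :=
  forall (s : 'S_n) (x : 'rV[R]_n), L (\row_i x ord0 (s i)) = L x.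

Definition monotone_symmetric_norm (R : realType) (n : nat) (L : 'rV[R]_n -> R) :=
  [/\ is_norm L, monotone_norm L & symmetric_norm L].

Definition output (R : realType) (n T : nat) := 'I_T -> 'rV[R]_n.

(* Measurable sets of outputs: the product (Borel) sigma-algebra on
   R^(T x n), generated by the coordinate preimages of Borel sets. *)
Definition output_measurable (R : realType) (n T : nat) (S : set (output R n T)) : Prop :=
  <<s [set G : set (output R n T) | exists (t : 'I_T) (i : 'I_n) (B : set R),
          measurable B /\ G = (fun E : output R n T => E t ord0 i) @^-1` B] >> S.

(* A randomized continual mechanism: a deterministic map of the stream and
   of the random seed omega drawn from P. *)
Definition mechanism (R : realType) (d : measure_display) (Omega : measurableType d)
  (n T : nat) := stream n T -> Omega -> output R n T.

Definition mech_measurable (R : realType) d (Omega : measurableType d) (n T : nat)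
  (M : mechanism R Omega n T) : Prop :=
  forall u S, output_measurable S -> measurable (M u @^-1` S).

Definition continual (R : realType) d (Omega : measurableType d) (n T : nat)
  (M : mechanism R Omega n T) : Prop :=
  forall (u v : stream n T) (t : 'I_T), (forall s : 'I_T, (s <= t)%N -> u s = v s) ->
    forall w, M u w t = M v w t.

Definition eps_delta_DP (R : realType) d (Omega : measurableType d)
  (P : probability Omega R) (n T : nat) (M : mechanism R Omega n T) (eps delta : R) : Prop :=
  forall u v : stream n T, neighboring u v ->
    forall S, output_measurable S ->
      (P (M u @^-1` S) <= (expR eps)%:E * P (M v @^-1` S) + delta%:E)%E.

(* log with the usual O-notation convention that logs are at least 1. *)
Definition lg (R : realType) (x : R) : R := Num.max 1 (ln x).

(* Main.v *)
Require Import Defs.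
From HB Require Import structures.
From mathcomp Require Import all_boot all_order all_algebra all_fingroup.
From mathcomp Require Import all_classical all_reals all_analysis.
From mathcomp Require Import zify ring lra.
Import Order.TTheory GRing.Theory Num.Theory.
Local Open Scope classical_set_scope.
Local Open Scope ring_scope.
Set Implicit Arguments. Unset Strict Implicit. Unset Printing Implicit Defensive.

(** The mechanism is purely eps-differentially private and lives on a finite
    probability space. Put z = zeta / 16.

    A counter that changes by at most 1 between neighboring streams is tracked up
    to a factor 1 + z from a base value b on, by one sparse-vector (AboveThreshold)
    run per threshold b (1 + z)^j with geometric noise of rate H / (z b (1 + z)^j);
    the rates form a geometric series, so a whole counter costs only O(H / (z^2 b)),
    while the error of the j-th run is at most z times its threshold with failure
    probability exp(- H).

    Two families of counters are run. The universe is first hashed to 10 T^2 + 1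
    buckets, which with probability 9/10 merges no two elements of the stream and
    removes every dependence on n; the frequency of each bucket is tracked from a
    base b1 on (a neighboring stream affects two buckets). For the frequencies below
    (1 + z) b1, the m = O(log b1 / z) level counts #{i : f_i >= (1 + z)^l} are tracked
    from a base b2 on. As symmetric norms only see the sorted vector, both families
    combine into estimates of the order statistics. Only the fewer than (1 + z) b2
    elements with frequency below (1 + z) b1 can be lost, which yields an additive
    error O(b1 b2) = O(log^2 T Lam^3 / (eps^2 zeta^5)) with Lam the lower-order factor.
    When eps is so large that b1 or b2 reaches 1, the noise is zero where it matters
    and there is no additive error at all. *)

(** * Finite probability spaces as probability measures *)

Section FiniteProbability.
Context {R : realType} {W : finType} (p : W -> R).
Hypotheses (p0 : forall w, 0 <= p w) (p1 : \sum_w p w = 1).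

Definition prb (A : pred W) : R := \sum_(w | A w) p w.

(* The finite space is realized inside nat, whose sigma-algebra is discrete. *)
Lemma fin_probability_exists (w0 : W) :
  exists (P : probability nat R) (f : nat -> W),
    forall A : pred W, P [set k | A (f k)] = (prb A)%:E.
Proof.
pose m (i : nat) : {measure set nat -> \bar R} :=
  mscale (NngNum (p0 (nth w0 (enum W) i))) \d_i.
pose mu := msum m #|W|.
have muE (B : set nat) : mu B = (\sum_(i < #|W|) p (nth w0 (enum W) i) * \1_B (i : nat))%:E.
  rewrite /mu /msum -sumEFin; apply: eq_bigr => i _.
  by rewrite /m /= /mscale /= diracE EFinM indicE.
have muT : mu [set: nat] = 1%E.
  rewrite muE; congr (_%:E); rewrite -[RHS]p1.
  have -> : \sum_w p w = \sum_(w in W) p w by apply: eq_bigl.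
  rewrite [RHS]big_enum_val /=.
  by apply: eq_bigr => i _; rewrite indicT mulr1 (enum_val_nth w0).
pose Pm := Measure_isProbability.Build _ nat R mu muT.
pose P : probability nat R := HB.pack_for (probability nat R) mu Pm.
exists P, (nth w0 (enum W)) => A.
rewrite [LHS]muE; congr (_%:E).
have -> : prb A = \sum_(w in W) (if A w then p w else 0) by rewrite /prb big_mkcond.
rewrite [in RHS]big_enum_val /=; apply: eq_bigr => i _; rewrite indicE -(enum_val_nth w0).
case: ifP => Ai.
  by rewrite mem_set ?mulr1 //= -enum_val_nth.
by rewrite memNset ?mulr0 //= -enum_val_nth Ai.
Qed.

End FiniteProbability.

(** * Product laws on finite spaces *)

Section ProductProbability.
Context {R : realType} {I J : finType} (p : I -> J -> R).
Hypotheses (p0 : forall i x, 0 <= p i x) (p1 : forall i, \sum_x p i x = 1).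

Definition prod_pmf (w : {ffun I -> J}) : R := \prod_i p i (w i).

Lemma prod_pmf_ge0 w : 0 <= prod_pmf w.
Proof. exact: prodr_ge0. Qed.

Lemma prb_prod_pmf (A : I -> pred J) :
  prb prod_pmf [pred w : {ffun I -> J} | [forall i, A i (w i)]] = \prod_i prb (p i) (A i).
Proof.
under [RHS]eq_bigr => i _ do rewrite /prb big_mkcond.
rewrite bigA_distr_bigA /prb big_mkcond; apply: eq_bigr => w _ /=.
case: ifP => [/forallP Aw|/negbT]; first by apply: eq_bigr => i _; rewrite Aw.
by rewrite negb_forall => /existsP[i /negbTE Awi]; rewrite (bigD1 i) //= Awi mul0r.
Qed.

Lemma prod_pmf_sum1 : \sum_w prod_pmf w = 1.
Proof. by rewrite -(bigA_distr_bigA p) big1. Qed.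

Lemma prb_prod_coord (i : I) (A : pred J) :
  prb prod_pmf [pred w : {ffun I -> J} | A (w i)] = prb (p i) A.
Proof.
have -> : prb prod_pmf [pred w : {ffun I -> J} | A (w i)] =
    prb prod_pmf [pred w : {ffun I -> J} |
      [forall j, [pred x | (j == i) ==> A x] (w j)]].
  apply: eq_bigl => w; apply/idP/forallP => [/= Aw j|/(_ i)] /=.
    by apply/implyP => /eqP ->.
  by rewrite eqxx.
rewrite (prb_prod_pmf (fun j => [pred x | (j == i) ==> A x])) (bigD1 i) //=.
rewrite [X in _ * X]big1 ?mulr1 => [|j /negbTE ji].
  by apply: eq_bigl => x /=; rewrite eqxx.
by rewrite /prb -[RHS](p1 j); apply: eq_bigl => x /=; rewrite ji.
Qed.

Lemma prb_prod_coord2_eq (i i' : I) : i != i' ->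
  prb prod_pmf [pred w : {ffun I -> J} | w i == w i'] = \sum_x p i x * p i' x.
Proof.
move=> ii'; rewrite /prb (partition_big (fun w : {ffun I -> J} => w i) xpredT) //=.
apply: eq_bigr => x _.
pose A j := [pred y : J | (j \in [:: i; i']) ==> (y == x)].
transitivity (prb prod_pmf [pred w : {ffun I -> J} | [forall j, A j (w j)]]).
  apply: eq_bigl => w; apply/andP/forallP => [[/eqP wi /eqP wx] j|Aw].
    by rewrite /A /= !inE -wx; apply/implyP => /orP[/eqP ->|/eqP ->] //; rewrite wi.
  have := Aw i; have := Aw i'; rewrite /A /= !inE !eqxx orbT /=.
  by move=> /eqP -> /eqP ->.
rewrite (prb_prod_pmf A) (bigD1 i) //= (bigD1 i') 1?eq_sym //= mulrA.
rewrite [X in _ * X]big1 ?mulr1 => [|j /andP[/negbTE ji /negbTE ji']].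
  congr (_ * _); rewrite /prb /A.
    by rewrite (big_pred1 x) // => y /=; rewrite !inE eqxx.
  by rewrite (big_pred1 x) // => y /=; rewrite !inE eqxx orbT.
by rewrite /prb -[RHS](p1 j); apply: eq_bigl => y /=; rewrite !inE ji ji'.
Qed.

(** The change of noise behind privacy: the fibres of a coordinatewise map are products of
    coordinate fibres, so the density ratios [K i] multiply. Bounding whole fibres instead of single
    points lets [phi] be non-injective, as clamping is. *)
Lemma prb_prod_shift (phi : I -> J -> J) (K : I -> R) (A B : pred {ffun I -> J}) :
  (forall i, 0 <= K i) ->
  (forall i y, \sum_(x | phi i x == y) p i x <= K i * p i y) ->
  (forall w, A w -> B [ffun i => phi i (w i)]) ->
  prb prod_pmf A <= (\prod_i K i) * prb prod_pmf B.
Proof.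
move=> K0 Kp AB.
pose Phi (w : {ffun I -> J}) := [ffun i => phi i (w i)].
apply: (@le_trans _ _ (\sum_(w | B (Phi w)) prod_pmf w)).
  rewrite /prb big_mkcond [leRHS]big_mkcond; apply: ler_sum => w _ /=.
  case: ifP => [/AB -> //|_]; case: ifP => // _; exact: prod_pmf_ge0.
rewrite (partition_big Phi B) //= /prb mulr_sumr; apply: ler_sum => w' Bw'.
rewrite /prod_pmf -big_split /=.
apply: (@le_trans _ _ (\prod_i \sum_(x | phi i x == w' i) p i x)).
  under [leRHS]eq_bigr => i _ do rewrite big_mkcond.
  rewrite bigA_distr_bigA big_mkcond; apply: ler_sum => w _ /=.
  case: ifP => [/andP[_ /eqP <-]|_].
    by apply: ler_prod => i _; rewrite p0 /= ffunE eqxx.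
  by apply: prodr_ge0 => i _; case: ifP.
apply: ler_prod => i _; rewrite Kp andbT; exact: sumr_ge0.
Qed.

Lemma prb_union_le (W : finType) (P : W -> R) (C : finType) (A : pred W) (B : C -> pred W) :
  (forall w, 0 <= P w) -> (forall w, A w -> exists c, B c w) ->
  prb P A <= \sum_c prb P (B c).
Proof.
move=> P0 AB; rewrite /prb.
under [leRHS]eq_bigr => c _ do rewrite big_mkcond.
rewrite exchange_big big_mkcond /=; apply: ler_sum => w _.
case: ifP => [/AB[c Bc]|_]; last by apply: sumr_ge0 => c _; case: ifP.
by rewrite (bigD1 c) //= Bc lerDl; apply: sumr_ge0 => c' _; case: ifP.
Qed.

End ProductProbability.

(** * Truncated geometric noise *)

Section TruncatedGeometric.
Context {R : realType} (q : R) (D : nat).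
Hypotheses (q0 : 0 < q) (q1 : q <= 1).

(** The mass beyond [D] sits on the point [D], so the tails remain exactly [q ^+ y] for [y <= D]. *)
Definition trunc_geo (x : 'I_D.+1) : R := if (x < D)%N then q ^+ x * (1 - q) else q ^+ D.

Lemma trunc_geo_ge0 x : 0 <= trunc_geo x.
Proof.
rewrite /trunc_geo; case: ifP => _; last exact/exprn_ge0/ltW.
by apply: mulr_ge0; [exact/exprn_ge0/ltW|rewrite subr_ge0].
Qed.

Lemma trunc_geo_tail (y : nat) : (y <= D)%N ->
  \sum_(x : 'I_D.+1 | (y <= x)%N) trunc_geo x = q ^+ y.
Proof.
move=> yD.
rewrite (eq_bigr (fun x : 'I_D.+1 =>
  (fun k : nat => if (k < D)%N then q ^+ k - q ^+ k.+1 else q ^+ D) x)); last first.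
  by move=> x _; rewrite /trunc_geo; case: ifP => // _; rewrite mulrBr mulr1 exprSr.
rewrite -(big_mkord (fun k => y <= k)%N
  (fun k : nat => if (k < D)%N then q ^+ k - q ^+ k.+1 else q ^+ D)).
rewrite -[X in \sum_(0 <= _ < _ | X _) _]/(fun k => true && (y <= k)%N).
rewrite -big_nat_widenl // big_nat_recr //= ltnn.
rewrite (eq_big_nat _ _ (F2 := fun k => - q ^+ k.+1 - (- q ^+ k))); last first.
  by move=> k /andP[_ kD]; rewrite kD opprK addrC.
by rewrite (telescope_sumr (fun k => - q ^+ k)) // opprK addrAC addNr add0r.
Qed.

Lemma trunc_geo_sum1 : \sum_x trunc_geo x = 1.
Proof. by rewrite -[RHS](expr0 q) -(trunc_geo_tail (leq0n D)). Qed.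

Lemma trunc_geo_tail_le (y : nat) :
  \sum_(x : 'I_D.+1 | (y <= x)%N) trunc_geo x <= q ^+ y.
Proof.
case: (leqP y D) => yD; first by rewrite trunc_geo_tail.
rewrite big1 ?exprn_ge0 ?ltW // => x yx.
by have := leq_trans yD yx; rewrite ltnNge -ltnS ltn_ord.
Qed.

Definition clamp_add (s : nat) (x : 'I_D.+1) : 'I_D.+1 := inord (minn (x + s) D).

Lemma val_clamp_add s x : clamp_add s x = minn (x + s) D :> nat.
Proof. by rewrite inordK // ltnS geq_minr. Qed.

(** A point below [D] has at most the preimage [y - s], whose mass is larger by [q ^- s]; the fibre
    of [D] is the tail from [D - s] on. *)
Lemma trunc_geo_shift (s : nat) (y : 'I_D.+1) :
  \sum_(x | clamp_add s x == y) trunc_geo x <= q ^- s * trunc_geo y.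
Proof.
have qu : q \is a GRing.unit by rewrite unitfE gt_eqF.
have qs k : 0 < q ^+ k by exact: exprn_gt0.
case: (ltnP y D) => yD.
  case: (leqP s y) => sy; last first.
    rewrite big1 ?mulr_ge0 ?invr_ge0 ?(ltW (qs _)) ?trunc_geo_ge0 // => x /eqP/(congr1 val)/=.
    rewrite val_clamp_add; lia.
  have ysD : (y - s < D.+1)%N by lia.
  rewrite (big_pred1 (Ordinal ysD)) => [|x]; last first.
    by apply/eqP/eqP => /(congr1 val)/=; rewrite ?val_clamp_add => e; apply: val_inj;
      rewrite /= ?val_clamp_add; lia.
  rewrite /trunc_geo /= yD (leq_ltn_trans (leq_subr s y) yD).
  by rewrite expfB_cond ?gt_eqF // mulrA (mulrC (q ^- s)).
have yE : y = D :> nat by apply/eqP; rewrite eqn_leq yD -ltnS ltn_ord.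
rewrite (eq_bigl (fun x : 'I_D.+1 => (D - s <= x)%N)); last first.
  move=> x; apply/eqP/idP => [/(congr1 val)/=|Dx].
    by rewrite val_clamp_add yE; lia.
  by apply: val_inj; rewrite /= val_clamp_add yE; lia.
rewrite trunc_geo_tail ?leq_subr // /trunc_geo yE ltnn.
case: (leqP s D) => sD.
  by rewrite expfB_cond ?gt_eqF // mulrC.
(* Here [s] exceeds [D]: the fibre is the whole space and the bound reduces to
   [q ^+ s <= q ^+ D]. *)
have /eqP -> : (D - s == 0)%N by rewrite subn_eq0 ltnW.
rewrite expr0 mulrC ler_pdivlMr // mul1r.
exact: ler_wiXn2l (ltW q0) q1 _ _ (ltnW sD).
Qed.

End TruncatedGeometric.
Arguments clamp_add {D} s x.
Arguments trunc_geo {R} q {D} x.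

(** * Sparse vector: a single AboveThreshold run *)

Section AboveThreshold.
Context {R : realType} {T : nat} (X : nat).

(* Saturating the comparison at noise X makes the clamped noise behave exactly
   like an untruncated geometric one. *)
Definition crosses (th : R) (rho nu q : nat) : bool :=
  (X <= nu)%N || (th + rho%:R <= q%:R + nu%:R).

Definition fired (th : R) (rho : nat) (nu q : 'I_T -> nat) (t : 'I_T) : bool :=
  [exists s : 'I_T, (s <= t)%N && crosses th rho (nu s) (q s)].

Definition first_true (o : 'I_T -> bool) (t : 'I_T) : bool :=
  o t && [forall s : 'I_T, (s < t)%N ==> ~~ o s].

Lemma fired_mono th rho nu q (s t : 'I_T) :
  (s <= t)%N -> fired th rho nu q s -> fired th rho nu q t.
Proof.
move=> st /existsP[r /andP[rs c]]; apply/existsP; exists r.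
by rewrite (leq_trans rs st).
Qed.

Lemma exists_first_true (o : 'I_T -> bool) t : o t ->
  exists2 s : 'I_T, (s <= t)%N & first_true o s.
Proof.
move=> ot; have /existsP : exists s, o s by exists t.
case: (arg_minnP (fun s : 'I_T => nat_of_ord s) ot) => s os smin _.
exists s; first exact: smin.
rewrite /first_true os; apply/forallP => r; apply/implyP => rs.
by apply: contraL rs => /smin; rewrite leqNgt.
Qed.

Lemma first_true_uniq (o : 'I_T -> bool) s t : first_true o s -> first_true o t -> s = t.
Proof.
move=> /andP[os /forallP sm] /andP[ot /forallP tm]; apply: val_inj.
case: (ltngtP s t) => // [st|ts].
  by have := tm s; rewrite st os.
by have := sm t; rewrite ts ot.
Qed.

(** The sparse-vector argument with the output [o] held fixed. Raising the threshold noise by 1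
    keeps silent steps silent, as the query grows by at most 1; raising the query noise by 2 at the
    first firing step alone absorbs the higher threshold and a query drop of 1. *)
Lemma fired_shift (th : R) (rho : 'I_(X + T).+1) (nu : 'I_T -> 'I_(X + T).+1)
  (qu qv : 'I_T -> nat) (o : 'I_T -> bool) : 0 <= th ->
  (forall t, (qu t <= (qv t).+1)%N) -> (forall t, (qv t <= (qu t).+1)%N) ->
  (forall t, (qv t <= T)%N) ->
  (forall t, fired th rho (fun s => nu s) qu t = o t) ->
  forall t, fired th (clamp_add 1 rho)
    (fun s => clamp_add (if first_true o s then 2 else 0)%N (nu s)) qv t = o t.
Proof.
move=> th0 uv vu vT fo t; have rD := ltn_ord rho; have nD s := ltn_ord (nu s).
have e2 (a b : nat) : (a <= b)%N -> (a%:R <= b%:R :> R) by rewrite ler_nat.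
case ot : (o t).
  have [s st fs] := exists_first_true ot.
  apply/existsP; exists s; rewrite st /= fs /crosses !val_clamp_add /=.
  have := fs => /andP[os /forallP smin].
  have : crosses th rho (nu s) (qu s).
    move: (os); rewrite -fo => /existsP[r /andP[rs cr]].
    (* A crossing strictly before [s] would make [o] true before its first true step. *)
    case: (ltngtP r s) rs => // [rs _|/val_inj <- //].
    have := smin r; rewrite rs /= -fo => /negP[]; apply/existsP; exists r.
    by rewrite leqnn.
  rewrite /crosses => /orP[Xn|le]; first by apply/orP; left; lia.
  (* If the shift hits the cap [X + T], the noise is at least [X] and the comparison is
     saturated. *)
  case: (leqP (nu s + 2) (X + T)) => n2; last by apply/orP; left; lia.
  apply/orP; right; rewrite natrD.
  have h1 := e2 _ _ (geq_minl (rho + 1) (X + T)); have h2 := e2 _ _ (uv s).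
  rewrite !(natrD, mulrS) in h1 h2; lra.
rewrite /fired; apply/negbTE; apply/negP => /existsP[s /andP[st]].
have os : o s = false.
  by apply/negP; rewrite -fo => /(fired_mono st); rewrite fo ot.
rewrite /first_true os /= /crosses !val_clamp_add addn0.
have : ~~ crosses th rho (nu s) (qu s).
  apply/negP => c; move/negP: (negbT os); rewrite -fo; apply; apply/existsP; exists s.
  by rewrite leqnn.
rewrite /crosses negb_or -ltnNge -ltNge => /andP[nX lt].
have -> : minn (nu s) (X + T) = nu s by have := nD s; lia.
rewrite leqNgt nX /=; apply/negP; rewrite -ltNge.
have h2 := e2 _ _ (vu s); rewrite mulrS in h2.
case: (ltnP rho (X + T)) => rX.
  have -> : minn (rho + 1) (X + T) = (rho + 1)%N by lia.
  rewrite natrD; lra.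
(* A capped threshold noise cannot be crossed: the query is at most [T] and the query noise is below
   [X]. *)
have -> : minn (rho + 1) (X + T) = (X + T)%N by lia.
have h3 : (qv s + (nu s).+1 <= T + X)%N by apply: leq_add.
have := e2 _ _ h3; rewrite !natrD mulrS; lra.
Qed.

End AboveThreshold.

(** * Joint privacy of all runs *)

Section NoisyTable.
Context {R : realType} {T J X : nat} {Run : finType}.
Variables (th a : Run -> 'I_J -> R).
Hypotheses (th0 : forall r j, 0 <= th r j) (a0 : forall r j, 0 <= a r j).

Notation coord := (Run * 'I_J * option 'I_T)%type.
Notation noise := {ffun coord -> 'I_(X + T).+1}.
Notation table := {ffun (Run * 'I_J * 'I_T) -> bool}.

Definition noise_coord_pmf (c : coord) : 'I_(X + T).+1 -> R :=
  trunc_geo (expR (- a c.1.1 c.1.2)).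

Definition fired_table (q : Run -> 'I_T -> nat) (w : noise) : table :=
  [ffun c => fired X (th c.1.1 c.1.2) (w (c.1, None))
               (fun s => w (c.1, Some s)) (q c.1.1) c.2].

Lemma q_gt0 r j : 0 < expR (- a r j). Proof. exact: expR_gt0. Qed.

Lemma q_le1 r j : expR (- a r j) <= 1.
Proof. by rewrite -expR0 ler_expR oppr_le0. Qed.

Lemma noise_coord_ge0 c x : 0 <= noise_coord_pmf c x.
Proof. exact/trunc_geo_ge0/q_le1/q_gt0. Qed.

Lemma noise_coord_sum1 c : \sum_x noise_coord_pmf c x = 1.
Proof. exact/trunc_geo_sum1. Qed.

(** Outputs are treated one at a time, so the noise shift may depend on the first firing steps
    recorded in [o]. A run in [Aff] pays, for each [j], its rate once for the threshold and at most
    twice for the firing step; the other runs keep their noise. *)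
Lemma prb_fired_table_le (qu qv : Run -> 'I_T -> nat) (Aff : pred Run) (S : pred table) :
  (forall r t, (qu r t <= (qv r t).+1)%N) -> (forall r t, (qv r t <= (qu r t).+1)%N) ->
  (forall r t, (qv r t <= T)%N) -> (forall r, ~~ Aff r -> qu r =1 qv r) ->
  prb (prod_pmf noise_coord_pmf) [pred w | S (fired_table qu w)] <=
  expR (\sum_(r | Aff r) \sum_j 3 * a r j) *
  prb (prod_pmf noise_coord_pmf) [pred w | S (fired_table qv w)].
Proof.
move=> uv vu vT nAff.
have split_prb q : prb (prod_pmf noise_coord_pmf) [pred w | S (fired_table q w)] =
    \sum_(o | S o) prb (prod_pmf noise_coord_pmf) [pred w | fired_table q w == o].
  rewrite /prb (partition_big (fired_table q) S) //=.
  apply: eq_bigr => o So; apply: eq_bigl => w.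
  by case: eqP => [->|]; rewrite ?andbT ?andbF.
rewrite !split_prb mulr_sumr; apply: ler_sum => o _.
(* [None] carries the threshold noise, [Some t] the query noise of step [t]. *)
pose sh (c : coord) : nat :=
  if Aff c.1.1 then
    if c.2 is Some t then (if first_true (fun s => o (c.1, s)) t then 2 else 0)%N else 1%N
  else 0%N.
apply: le_trans (prb_prod_shift (phi := fun c => clamp_add (sh c))
  (K := fun c => expR (- a c.1.1 c.1.2) ^- sh c)
  (B := [pred w | fired_table qv w == o]) _ _ _ _) _.
- by move=> c x; exact: noise_coord_ge0.
- by move=> c; rewrite invr_ge0 exprn_ge0 // ltW // q_gt0.
- by move=> c y; apply: trunc_geo_shift; [exact: q_gt0|exact: q_le1].
- move=> w /eqP wo; apply/eqP/ffunP => -[[r j] t]; rewrite ffunE /=.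
  have wor s : fired X (th r j) (w (r, j, None)) (fun s => w (r, j, Some s)) (qu r) s
      = o (r, j, s) by rewrite -wo ffunE.
  case Ar : (Aff r).
    rewrite !ffunE /sh /= Ar.
    rewrite -[RHS](fired_shift (th0 r j) (uv r) (vu r) (vT r) wor).
    by rewrite /fired; apply: eq_existsb => s; rewrite ffunE /= Ar.
  rewrite -wor /fired; apply: eq_existsb => s; rewrite !ffunE /sh /= Ar.
  have c0 x : clamp_add 0 x = x :> 'I_(X + T).+1.
    by apply: val_inj; rewrite /= val_clamp_add; have := ltn_ord x; lia.
  by rewrite !c0 (nAff r) ?Ar.
apply: ler_wpM2r; first by apply: sumr_ge0 => w _; apply: prod_pmf_ge0; exact: noise_coord_ge0.
have -> : \prod_(c : coord) expR (- a c.1.1 c.1.2) ^- sh c =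
    expR (\sum_(c : coord) a c.1.1 c.1.2 * (sh c)%:R).
  rewrite expR_sum; apply: eq_bigr => c _.
  by rewrite -expRM_natr mulNr expRN invrK.
rewrite ler_expR.
rewrite -(pair_bigA _ (fun rj ot => a rj.1 rj.2 * (sh (rj, ot))%:R)) /=.
rewrite (eq_bigr (fun rj => \sum_ot a rj.1 rj.2 * (sh (rj.1, rj.2, ot))%:R)) => [|[]//].
rewrite -(pair_bigA _ (fun r j => \sum_ot a r j * (sh (r, j, ot))%:R)) /=.
rewrite [leRHS]big_mkcond; apply: ler_sum => r _.
case Ar : (Aff r); last first.
  by rewrite big1 // => j _; rewrite big1 // => ot _; rewrite /sh /= Ar mulr0.
apply: ler_sum => j _; rewrite -mulr_sumr mulrC; apply: ler_wpM2r => //.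
(* The total shift is at most 3: 1 from [None], and 2 from at most one step because the first true
   step is unique. *)
rewrite -natr_sum ler_nat (bigD1 None) //= {1}/sh /= Ar addSn add0n ltnS.
case: (pickP (first_true (fun s => o (r, j, s)))) => [t ft|nf].
  rewrite (bigD1 (Some t)) //= big1 ?addn0 => [|[s|] /andP[]//= _ st].
    by rewrite /sh /= Ar ft.
  rewrite /sh /= Ar; case: ifP => // /(first_true_uniq ft) ts.
  by rewrite ts eqxx in st.
by rewrite big1 // => -[s|] //= _; rewrite /sh /= Ar nf.
Qed.

End NoisyTable.

(** * Monotone symmetric norms and level counts *)

Section Norms.
Context {R : realType} {n : nat}.
Implicit Types (x y h : 'rV[R]_n) (L : 'rV[R]_n -> R).

Lemma widen_ord_inj {a b : nat} (ab : (a <= b)%N) : injective (widen_ord ab).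
Proof. by move=> i j /(congr1 val) /= /val_inj. Qed.

Definition ge_count x (s : R) : nat := #|[pred i : 'I_n | s <= x ord0 i]|.

Lemma ge_count_perm x (p : 'S_n) s :
  ge_count (\row_i x ord0 (p i)) s = ge_count x s.
Proof.
rewrite /ge_count -!sum1_card [RHS](reindex_inj (@perm_inj _ p)) /=.
by apply: eq_bigl => i; rewrite !inE mxE.
Qed.

Lemma perm_sort_desc x :
  exists p : 'S_n, forall i j : 'I_n, (i <= j)%N -> x ord0 (p j) <= x ord0 (p i).
Proof.
pose t := [tuple x ord0 i | i < n].
pose s := sort (fun a b : R => b <= a) t.
have /tuple_permP[p sE] : perm_eq s t by rewrite /s perm_sort.
have sS : sorted (fun a b : R => b <= a) s.
  by apply: sort_sorted => a b; exact: le_total.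
exists p => i j ij.
have sn k (kn : (k < n)%N) : nth 0 s k = x ord0 (p (Ordinal kn)).
  rewrite sE -[k in nth _ _ k]/(nat_of_ord (Ordinal kn)) -tnth_nth.
  by rewrite tnth_mktuple /t tnth_mktuple.
have sln := sorted_leq_nth (leT := fun a b : R => b <= a) _ _ 0 sS.
have := sln (fun a b c ab bc => le_trans bc ab) (fun a => lexx a) i j.
have szs : size s = n by rewrite size_sort size_tuple.
rewrite !inE szs !ltn_ord => /(_ isT isT ij).
rewrite !sn; congr (x _ (p _) <= x _ (p _)); exact: val_inj.
Qed.

(** In a descending vector the entries reaching [s] form an initial segment, so its size decides
    membership. *)
Lemma sorted_ge_count x (i : 'I_n) s :
  (forall j k : 'I_n, (j <= k)%N -> x ord0 k <= x ord0 j) ->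
  (s <= x ord0 i) = (i < ge_count x s)%N.
Proof.
move=> xS; apply/idP/idP => [sx|].
  rewrite -[X in (X <= _)%N](card_ord i.+1).
  rewrite -[X in (X <= _)%N](fintype.card_image (widen_ord_inj (ab := ltn_ord i))).
  apply: subset_leq_card; apply/fintype.subsetP => j /fintype.imageP[k _ ->].
  by rewrite !inE; apply: le_trans sx _; apply: xS; rewrite /= -ltnS.
apply: contraTT; rewrite -ltNge -leqNgt => xs.
rewrite -[X in (_ <= X)%N](card_ord i).
rewrite -[X in (_ <= X)%N](fintype.card_image (widen_ord_inj (ab := ltnW (ltn_ord i)))).
apply: subset_leq_card; apply/fintype.subsetP => j; rewrite !inE => le.
have ji : (j < i)%N.
  rewrite ltnNge; apply/negP => /xS le'.
  by have := le_lt_trans (le_trans le le') xs; rewrite ltxx.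
apply/fintype.imageP; exists (Ordinal ji) => //; exact: val_inj.
Qed.

Lemma ge_count_anti x (s s' : R) : s <= s' -> (ge_count x s' <= ge_count x s)%N.
Proof.
move=> ss'; apply: subset_leq_card; apply/fintype.subsetP => i; rewrite !inE.
exact: le_trans.
Qed.

Lemma ge_count_le x s : (ge_count x s <= n)%N.
Proof. by rewrite /ge_count (leq_trans (max_card _)) ?card_ord. Qed.

Lemma ge_countZ (c : R) x s : 0 < c -> ge_count (c *: x) s = ge_count x (s / c).
Proof.
by move=> c0; apply: eq_card => i; rewrite !inE mxE ler_pdivrMr // mulrC.
Qed.

(** By symmetry both vectors may be sorted in descending order. Comparing the counts at the level of
    the [i]-th entry of [x] bounds that entry by the [i]-th entry of [y], and monotonicity
    applies. *)
Lemma norm_le_of_ge_count L x y : monotone_symmetric_norm L ->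
  (forall i, 0 <= x ord0 i) -> (forall i, 0 <= y ord0 i) ->
  (forall s : R, 0 < s -> (ge_count x s <= ge_count y s)%N) -> L x <= L y.
Proof.
move=> [_ mL sL] x0 y0 xy.
have [p pP] := perm_sort_desc x; have [q qP] := perm_sort_desc y.
rewrite -(sL p x) -(sL q y); apply: mL => i; rewrite !mxE !ger0_norm //.
have := xy (x ord0 (p i)); case: (ltrgt0P (x ord0 (p i))) (x0 (p i)) => // [s0 _|-> //].
move=> /(_ isT); rewrite -(ge_count_perm x p) -(ge_count_perm y q) => le.
have pS (j k : 'I_n) : (j <= k)%N ->
    (\row_j x ord0 (p j)) ord0 k <= (\row_j x ord0 (p j)) ord0 j.
  by move=> jk; rewrite !mxE; exact: pP.
have qS (j k : 'I_n) : (j <= k)%N ->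
    (\row_j y ord0 (q j)) ord0 k <= (\row_j y ord0 (q j)) ord0 j.
  by move=> jk; rewrite !mxE; exact: qP.
have := sorted_ge_count i (x ord0 (p i)) qS; rewrite mxE => ->.
by apply: leq_trans le; rewrite -(sorted_ge_count _ _ pS) mxE.
Qed.

(** Triangle inequality over the unit vectors, each of norm at most that of [e1] by symmetry. *)
Lemma norm_le_sum L x : monotone_symmetric_norm L ->
  L x <= (\sum_i `|x ord0 i|) * L (e1 R n).
Proof.
move=> [[L0 _ LZ LD] mL sL].
have Lz : L 0 = 0 by rewrite -(scale0r (0 : 'rV_n)) LZ normr0 mul0r.
have Lsum (I : Type) (r : seq I) (F : I -> 'rV_n) :
    L (\sum_(i <- r) F i) <= \sum_(i <- r) L (F i).
  elim: r => [|a r IH]; first by rewrite !big_nil Lz.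
  by rewrite !big_cons; apply: le_trans (LD _ _) _; rewrite lerD2l.
rewrite {1}(row_sum_delta x) mulr_suml.
apply: le_trans (Lsum _ _ _) _; apply: ler_sum => i _.
rewrite LZ; apply: ler_wpM2l => //.
have n0 : (0 < n)%N by case: (n) i => // -[].
rewrite -(sL (tperm i (Ordinal n0)) (e1 R n)).
apply: mL => j; rewrite !mxE /=.
case: (altP (j =P i)) => [->|ji] /=.
  by rewrite tpermL eqxx.
by rewrite normr0.
Qed.

Lemma card_ord_lt (c : nat) : (c <= n)%N -> #|[pred r : 'I_n | (r < c)%N]| = c.
Proof.
move=> cn; rewrite -[RHS](card_ord c) -(fintype.card_image (widen_ord_inj (ab := cn))).
apply: eq_card => j; rewrite !inE; apply/idP/fintype.imageP => [jc|[k _ ->]].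
  by exists (Ordinal jc) => //; exact: val_inj.
exact: (ltn_ord k).
Qed.

(** The indices [k * p.+1 + o] with [k < c %/ p.+1] lie below [c] and are all deleted. *)
Lemma card_residue (p c o : nat) : (c <= n)%N -> (o <= p)%N ->
  (#|[pred r : 'I_n | (r < c)%N && (r %% p.+1 != o)%N]| <= c - c %/ p.+1)%N.
Proof.
move=> cn op; rewrite leq_subRL; last exact: leq_div.
rewrite -[X in (_ <= X)%N](card_ord_lt cn).
rewrite -(cardID [pred r : 'I_n | (r %% p.+1 == o)%N] [pred r : 'I_n | (r < c)%N]).
apply: leq_add; last first.
  by apply: subset_leq_card; apply/fintype.subsetP => r; rewrite !inE andbC.
have kc (k : 'I_(c %/ p.+1)) : (k * p.+1 + o < c)%N.
  have := leq_divM c p.+1.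
  have : (k.+1 * p.+1 <= c %/ p.+1 * p.+1)%N by rewrite leq_mul2r ltn_ord orbT.
  rewrite mulSn; lia.
pose f k := Ordinal (leq_trans (kc k) cn).
have fI : injective f.
  by move=> a b /(congr1 val) /= /addIn /eqP; rewrite eqn_pmul2r // => /eqP /val_inj.
rewrite -[X in (X <= _)%N](card_ord (c %/ p.+1)) -(fintype.card_image fI).
apply: subset_leq_card; apply/fintype.subsetP => r /fintype.imageP[k _ ->].
by rewrite !inE /= modnMDl modn_small ?eqxx ?kc.
Qed.

(* The p.+1 vectors obtained from h by deleting one residue class of indices sum
   to p times h; this trades relative errors on counts for one on the norm. *)
Lemma norm_le_residues L h y (p : nat) : monotone_symmetric_norm L ->
  (forall i, 0 <= h ord0 i) -> (forall i, 0 <= y ord0 i) ->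
  (forall (s : R) (o : nat), 0 < s -> (o <= p)%N ->
     (#|[pred r : 'I_n | (s <= h ord0 r)%R && (r %% p.+1 != o)%N]| <= ge_count y s)%N) ->
  p%:R * L h <= p.+1%:R * L y.
Proof.
move=> Lmsn h0 y0 cnt.
have [[L0 _ LZ LD] mL sL] := Lmsn.
pose F (o : nat) := \row_r (if (r %% p.+1 == o)%N then 0 else h ord0 r) : 'rV[R]_n.
have LF o : (o <= p)%N -> L (F o) <= L y.
  move=> op; apply: norm_le_of_ge_count => // [i|s s0].
    by rewrite mxE; case: ifP.
  apply: leq_trans (cnt s o s0 op); apply: subset_leq_card.
  apply/fintype.subsetP => r; rewrite !inE mxE.
  by case: ifP => _; rewrite ?andbT // => /(lt_le_trans s0); rewrite ltxx.
have sumF : \sum_(o < p.+1) F o = p%:R *: h.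
  apply/rowP => r; rewrite summxE mxE.
  pose o0 := Ordinal (ltn_pmod r (ltn0Sn p)).
  rewrite (bigD1 o0) //= mxE eqxx add0r.
  under eq_bigr => o oo0.
    rewrite mxE ifN; first over.
    by apply: contra oo0 => /eqP e; apply/eqP/val_inj; rewrite /= e.
  rewrite sumr_const -[#|_|]/(#|predC1 o0|) cardC1 card_ord /=.
  by rewrite mulr_natl.
have Lz : L 0 = 0 by rewrite -(scale0r (0 : 'rV_n)) LZ normr0 mul0r.
have Lsum (I : Type) (r : seq I) (G : I -> 'rV_n) :
    L (\sum_(i <- r) G i) <= \sum_(i <- r) L (G i).
  elim: r => [|a r IH]; first by rewrite !big_nil Lz.
  by rewrite !big_cons; apply: le_trans (LD _ _) _; rewrite lerD2l.
rewrite -[p%:R]ger0_norm ?ler0n // -LZ -sumF.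
apply: le_trans (Lsum _ _ _) _.
apply: (@le_trans _ _ (\sum_(o < p.+1) L y)).
  by apply: ler_sum => o _; apply: LF; rewrite -ltnS.
by rewrite sumr_const card_ord mulr_natl.
Qed.

Lemma norm_le_of_scaled_count L x y (c : R) : monotone_symmetric_norm L -> 0 < c ->
  (forall i, 0 <= x ord0 i) -> (forall i, 0 <= y ord0 i) ->
  (forall s : R, 0 < s -> (ge_count y s <= ge_count x (s / c))%N) ->
  L y <= c * L x.
Proof.
move=> Lmsn c0 x0 y0 yx; have [[_ _ LZ _] _ _] := Lmsn.
rewrite -[c]gtr0_norm // -LZ; apply: norm_le_of_ge_count => // [i|s s0].
  by rewrite mxE mulr_ge0 // ltW.
by rewrite ge_countZ //; exact: yx.
Qed.

(* The coordinates below K of rank less than A, for which y carries no information,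
   are charged to the additive error. *)
Lemma norm_le_of_approx_count L x y (p A : nat) (c K : R) :
  monotone_symmetric_norm L -> 0 < c -> 0 < K ->
  (forall i, 0 <= x ord0 i) -> (forall i, 0 <= y ord0 i) ->
  (forall s : R, K <= s -> (ge_count x s <= ge_count y (s / c))%N) ->
  (forall s : R, 0 < s -> s < K -> (ge_count x s < A)%N \/
     (p * ge_count x s <= p.+1 * ge_count y (s / c))%N) ->
  p%:R * L x <= p.+1%:R * (c * L y) + p%:R * (A%:R * K * L (e1 R n)).
Proof.
move=> Lmsn c0 K0 x0 y0 big small; have [[L0 _ LZ LD] _ sL] := Lmsn.
have [q qP] := perm_sort_desc x.
pose g := \row_i x ord0 (q i) : 'rV[R]_n.
have gS (j k : 'I_n) : (j <= k)%N -> g ord0 k <= g ord0 j.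
  by move=> jk; rewrite !mxE; exact: qP.
have g0 i : 0 <= g ord0 i by rewrite mxE.
(* The vector [b] collects the uninformative entries: at most [A] of them, each below [K]. *)
pose h := \row_r (if (K <= g ord0 r) || (A <= r)%N then g ord0 r else 0) : 'rV[R]_n.
pose b := \row_r (if (K <= g ord0 r) || (A <= r)%N then 0 else g ord0 r) : 'rV[R]_n.
have gE : g = h + b.
  by apply/rowP => r; rewrite !mxE; case: ifP; rewrite ?addr0 ?add0r.
have h0 i : 0 <= h ord0 i by rewrite mxE; case: ifP.
have hle s r : 0 < s -> s <= h ord0 r -> s <= g ord0 r /\ (K <= g ord0 r \/ (A <= r)%N).
  move=> s0; rewrite mxE; case: ifP => [/orP ? //|_ /(lt_le_trans s0)].
  by rewrite ltxx.
rewrite -(sL q) -/g gE.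
apply: le_trans (ler_wpM2l _ (LD h b)) _ => //; rewrite mulrDr; apply: lerD.
  have -> : c * L y = L (c *: y) by rewrite LZ gtr0_norm.
  apply: norm_le_residues => // [i|s o s0 op].
    by rewrite mxE mulr_ge0 // ltW.
  rewrite ge_countZ //.
  case: (lerP K s) => [Ks|sK].
    apply: leq_trans (big _ Ks); rewrite -(ge_count_perm x q).
    apply: subset_leq_card; apply/fintype.subsetP => r; rewrite !inE.
    by move=> /andP[/(hle _ _ s0)[]].
  (* If fewer than [A] entries reach [s], an entry of [h] reaching [s] has rank below [A], hence is
     at least [K], and the count at [K] suffices. *)
  case: (small s s0 sK) => [cA|pc].
    apply: (@leq_trans (ge_count x K)).
      rewrite -(ge_count_perm x q).
      apply: subset_leq_card; apply/fintype.subsetP => r; rewrite !inE.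
      move=> /andP[/(hle _ _ s0)[sg [//|Ar]] _].
      move: sg; rewrite (sorted_ge_count _ _ gS) ge_count_perm => /ltn_trans/(_ cA).
      by rewrite ltnNge Ar.
    apply: leq_trans (big _ (lexx K)) _; apply: ge_count_anti.
    by rewrite ler_pM2r ?invr_gt0 // ltW.
  (* Deleting a residue class removes enough indices to absorb the ratio [p / p.+1] between the
     counts. *)
  apply: (@leq_trans (ge_count x s - ge_count x s %/ p.+1)).
    apply: leq_trans (card_residue (ge_count_le x s) op).
    apply: subset_leq_card; apply/fintype.subsetP => r; rewrite !inE.
    move=> /andP[/(hle _ _ s0)[sg _] ->]; rewrite andbT.
    by move: sg; rewrite (sorted_ge_count _ _ gS) ge_count_perm.
  rewrite leq_subLR addnC -leq_subLR leq_divRL // mulnBl; move: pc.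
  rewrite !mulSn; lia.
apply: ler_wpM2l => //; apply: le_trans (norm_le_sum _ Lmsn) _.
apply: ler_wpM2r => //.
apply: (@le_trans _ _ (\sum_(r < n | (r < A)%N) K)).
  rewrite [leRHS]big_mkcond; apply: ler_sum => r _; rewrite mxE.
  case: (lerP K (g ord0 r)) => [_|gK] /=; first by rewrite normr0; case: ifP => // _; exact: ltW.
  rewrite leqNgt; case: (ltnP r A) => rA /=; last by rewrite normr0.
  by rewrite ger0_norm // ltW.
rewrite sumr_const -[leLHS]mulr_natl ler_pM2r //.
rewrite ler_nat; case: (leqP A n) => [An|/ltnW nA]; first by rewrite (card_ord_lt An).
by apply: leq_trans (max_card _) _; rewrite card_ord.
Qed.

End Norms.

(** * Stream statistics and their sensitivity *)

Lemma in_set_pred (U : Type) (b : pred U) (x : U) : (x \in [set y | b y]) = b x.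
Proof. by apply/idP/idP => [/set_mem|/mem_set]. Qed.

Section StreamCounts.
Context {R : realType} {n T : nat}.

Definition count_upto {K : eqType} (v : 'I_T -> option K) (t : 'I_T) (k : K) : nat :=
  #|[pred s : 'I_T | (s <= t)%N && (v s == Some k)]|.

Lemma freqE (u : stream n T) (t : 'I_T) i : freq R u t ord0 i = (count_upto u t i)%:R.
Proof.
rewrite mxE; congr (_%:R); apply: eq_card => s.
by rewrite in_set_pred.
Qed.

Lemma count_upto_le {K : eqType} (v : 'I_T -> option K) t k : (count_upto v t k <= T)%N.
Proof. by rewrite (leq_trans (max_card _)) ?card_ord. Qed.

Lemma count_upto_mono {K : eqType} (v : 'I_T -> option K) (s t : 'I_T) k :
  (s <= t)%N -> (count_upto v s k <= count_upto v t k)%N.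
Proof.
move=> st; apply: subset_leq_card; apply/fintype.subsetP => r; rewrite !inE.
by move=> /andP[rs ->]; rewrite (leq_trans rs st).
Qed.

Lemma neighboringP (u v : stream n T) : neighboring u v ->
  forall s s', u s != v s -> u s' != v s' -> s = s'.
Proof.
move=> uv s s' us us'; apply/eqP; move: uv; apply: contraTT => ss'.
rewrite /neighboring -ltnNge; apply/card_geqP.
exists [:: s; s']; rewrite /= inE ss'; split => // x; rewrite in_set_pred !inE.
by move=> /orP[/eqP ->|/eqP ->].
Qed.

Definition differ_at (K : eqType) (u v : 'I_T -> option K) (k : K) : bool :=
  [exists s, (u s != v s) && ((u s == Some k) || (v s == Some k))].

Lemma count_upto_eq (K : eqType) (u v : 'I_T -> option K) t k :
  ~~ differ_at u v k -> count_upto u t k = count_upto v t k.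
Proof.
rewrite negb_exists => /forallP d; apply: eq_card => s; rewrite !inE.
congr (_ && _); have := d s; rewrite negb_and negbK => /orP[/eqP -> //|].
by rewrite negb_or => /andP[/negbTE -> /negbTE ->].
Qed.

Lemma count_upto_diff (K : eqType) (u v : 'I_T -> option K) t k :
  (forall s s', u s != v s -> u s' != v s' -> s = s') ->
  (count_upto u t k <= (count_upto v t k).+1)%N.
Proof.
move=> uv; rewrite -addn1 /count_upto.
rewrite -(cardID [pred s | u s == v s] [pred s : 'I_T | (s <= t)%N && (u s == Some k)]).
apply: leq_add.
  apply: subset_leq_card; apply/fintype.subsetP => s; rewrite !inE.
  by move=> /andP[/andP[-> us] /eqP <-].
apply/fintype.card_le1_eqP => s s'; rewrite !inE => /andP[us _] /andP[us' _].
exact: uv.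
Qed.

(** The single differing step involves only its key under [u] and its key under [v]. *)
Lemma card_differ_at (K : finType) (u v : 'I_T -> option K) :
  (forall s s', u s != v s -> u s' != v s' -> s = s') ->
  (#|[pred k | differ_at u v k]| <= 2)%N.
Proof.
move=> uv; have one (w : 'I_T -> option K) :
    (#|[pred k | [exists s, (u s != v s) && (w s == Some k)]]| <= 1)%N.
  apply/fintype.card_le1_eqP => k k'; rewrite !inE.
  move=> /existsP[s /andP[us /eqP wk]] /existsP[s' /andP[us' /eqP wk']].
  by move: wk; rewrite (uv _ _ us us') wk' => -[].
rewrite -[2%N]/(1 + 1)%N; apply: leq_trans (leq_add (one u) (one v)).
rewrite -cardUI; apply: leq_trans (leq_addr _ _).
apply: subset_leq_card; apply/fintype.subsetP => k; rewrite !inE.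
move=> /existsP[s /andP[us /orP[k1|k1]]]; apply/orP; [left|right];
  by apply/existsP; exists s; rewrite us.
Qed.

Definition level_count (kappa : R) (u : stream n T) (t : 'I_T) : nat :=
  #|[pred i | kappa <= (count_upto u t i)%:R]|.

Lemma ge_count_freq (u : stream n T) t s : ge_count (freq R u t) s = level_count s u t.
Proof. by apply: eq_card => i; rewrite !inE freqE. Qed.

Lemma level_count_mono kappa u (s t : 'I_T) :
  (s <= t)%N -> (level_count kappa u s <= level_count kappa u t)%N.
Proof.
move=> st; apply: subset_leq_card; apply/fintype.subsetP => i; rewrite !inE.
by move=> /le_trans; apply; rewrite ler_nat count_upto_mono.
Qed.

(** A positive level only counts elements occurring in the stream, and [T] steps insert at most [T]
    of them, whatever [n] is. *)
Lemma level_count_le kappa u t : 0 < kappa -> (level_count kappa u t <= T)%N.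
Proof.
move=> k0; rewrite -[leqRHS](card_ord T).
apply: (@leq_trans #|[pred i | Some i \in codom u]|).
  apply: subset_leq_card; apply/fintype.subsetP => i; rewrite !inE => ki.
  have : (0 < count_upto u t i)%N by rewrite -(ltr_nat R); exact: lt_le_trans ki.
  move=> /card_gt0P[s]; rewrite !inE => /andP[_ /eqP <-]; exact: codom_f.
apply: leq_trans (leq_image_card u 'I_T).
have sI : injective (@Some 'I_n) by move=> i j [].
rewrite -(fintype.card_image sI).
by apply: subset_leq_card; apply/fintype.subsetP => o /fintype.imageP[i ui ->].
Qed.

(** An element with a larger count under [u] is inserted by [u] at the one differing step, so at
    most one element can enter the level set. *)
Lemma level_count_diff kappa (u v : stream n T) t :
  (forall s s', u s != v s -> u s' != v s' -> s = s') ->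
  (level_count kappa u t <= (level_count kappa v t).+1)%N.
Proof.
move=> uv; rewrite -addn1 /level_count.
rewrite -(cardID [pred i | (count_upto u t i <= count_upto v t i)%N]
  [pred i | kappa <= (count_upto u t i)%:R]).
apply: leq_add.
  apply: subset_leq_card; apply/fintype.subsetP => i; rewrite !inE.
  by move=> /andP[/le_trans le cle]; apply: le; rewrite ler_nat.
have ex i : ~~ (count_upto u t i <= count_upto v t i)%N -> exists2 s, u s != v s & u s = Some i.
  move=> nle; case: (pickP [pred s | (u s != v s) && (u s == Some i)]) => [s /andP[us /eqP ui]|no].
    by exists s.
  case/negP: nle; apply: subset_leq_card; apply/fintype.subsetP => s; rewrite !inE.
  move=> /andP[-> us] /=; have := no s; rewrite /= us andbT => /negbFE/eqP <-.
  exact: us.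
apply/fintype.card_le1_eqP => i i'; rewrite !inE => /andP[/ex[s us ui] _].
move=> /andP[/ex[s' us' ui'] _].
by move: ui; rewrite (uv _ _ us us') ui' => -[].
Qed.

End StreamCounts.

(** * The estimator: from firing tables to order statistics *)

Section Estimator.
Context {R : realType} {n T N m J : nat}.
Variables (z b1 b2 : R).
Hypotheses (z0 : 0 < z) (z1 : z <= 1 / 32) (b1_ge1 : 1 <= b1) (b2_ge1 : 1 <= b2).
(** The grid of powers covers all query values, which are at most [T]. *)
Hypothesis TJ : T%:R < (1 + z) ^+ J.

Notation run := ('I_N.+1 + 'I_m)%type.
Notation table := {ffun (run * 'I_J * 'I_T) -> bool}.

Definition base (r : run) : R := if r is inl _ then b1 else b2.

Definition threshold (r : run) (j : 'I_J) : R := base r * (1 + z) ^+ j.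

Definition query (h : 'I_n -> 'I_N.+1) (u : stream n T) (r : run) (t : 'I_T) : nat :=
  match r with
  | inl b => count_upto (fun s => omap h (u s)) t b
  | inr l => level_count ((1 + z) ^+ l) u t
  end.

Definition num_fired (o : table) (t : 'I_T) (j : 'I_J) : nat := #|[pred b | o (inl b, j, t)]|.

(* The r-th coordinate is the estimate of the r-th largest frequency. *)
Definition estimate (o : table) (t : 'I_T) : 'rV[R]_n :=
  \row_r Num.max
    (\big[Num.max/0]_(j | (r < num_fired o t j)%N) (b1 * (1 + z) ^+ j))
    (\big[Num.max/0]_(lj : 'I_m * 'I_J |
        o (inr lj.1, lj.2, t) && (r%:R < (1 - z) * (b2 * (1 + z) ^+ lj.2)))
      (1 + z) ^+ lj.1).

Lemma estimate_ge (o : table) t (r : 'I_n) (s : R) : 0 < s ->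
  s <= estimate o t ord0 r <->
  (exists2 j : 'I_J, (r < num_fired o t j)%N & s <= b1 * (1 + z) ^+ j) \/
  (exists l j, [/\ o (inr l, j, t), r%:R < (1 - z) * (b2 * (1 + z) ^+ j)
                 & s <= (1 + z) ^+ l]).
Proof.
move=> s0; rewrite mxE le_max; split.
  move=> /orP[] /bigmax_geP[/(lt_le_trans s0)|]; rewrite ?ltxx //; first by left.
  by move=> [[l j] /= /andP[olj rj] sl]; right; exists l, j.
case=> [[j rj sj]|[l [j [olj rj sl]]]]; apply/orP; [left|right]; apply/bigmax_geP; right.
  by exists j.
by exists (l, j); rewrite //= olj.
Qed.

Lemma estimate_ge0 o t r : 0 <= estimate o t ord0 r.
Proof. by rewrite mxE le_max; apply/orP; left; exact: bigmax_ge_id. Qed.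

Lemma le_ge_count (x : 'rV[R]_n) (s : R) (k : nat) : (k <= n)%N ->
  (forall r : 'I_n, (r < k)%N -> s <= x ord0 r) -> (k <= ge_count x s)%N.
Proof.
move=> kn xs; rewrite -(card_ord_lt kn); apply: subset_leq_card.
by apply/fintype.subsetP => r; rewrite !inE => /xs.
Qed.

Lemma power_bracket (c x : R) (k : nat) : c <= x -> x < c * (1 + z) ^+ k ->
  exists2 j : 'I_k, c * (1 + z) ^+ j <= x & x < c * (1 + z) ^+ j.+1.
Proof.
move=> cx; elim: k => [|k IH]; first by rewrite expr0 mulr1 ltNge cx.
case: (ltrP x (c * (1 + z) ^+ k)) => [/IH[j le lt] _|le lt].
  by exists (widen_ord (leqnSn k) j).
by exists ord_max.
Qed.

(** * Accuracy of the estimate for a good table *)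

Variables (h : 'I_n -> 'I_N.+1) (u : stream n T) (t : 'I_T) (o : table).
Hypothesis h_inj : forall s s' i i',
  u s = Some i -> u s' = Some i' -> h i = h i' -> i = i'.
Hypothesis fired_ge : forall r j, o (r, j, t) -> (1 - z) * threshold r j <= (query h u r t)%:R.
Hypothesis unfired_lt : forall r j, ~~ o (r, j, t) -> (query h u r t)%:R < (1 + z) * threshold r j.
(** The noise is integral, so an allowance below 1 means no noise at all. This is what makes base 1
    free of additive error. *)
Hypothesis unfired_lt_small : forall r j, ~~ o (r, j, t) -> z * threshold r j < 1 ->
  (query h u r t)%:R < threshold r j.

Notation f := (freq R u t).

(** Without collisions the hash is a count-preserving bijection from the elements present onto the
    nonempty buckets; [0 < s] leaves out the empty ones. *)
Lemma bucket_count (s : R) : 0 < s ->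
  #|[pred b | s <= (query h u (inl b) t)%:R]| = ge_count f s.
Proof.
move=> s0; rewrite ge_count_freq /level_count.
have ex i : 0 < (count_upto u t i)%:R :> R -> exists r, u r = Some i.
  rewrite (ltr_nat _ 0) => /card_gt0P[r]; rewrite !inE => /andP[_ /eqP ur].
  by exists r.
have cE i r : u r = Some i -> count_upto (fun s => omap h (u s)) t (h i) = count_upto u t i.
  move=> ur; apply: eq_card => r'; rewrite !inE; congr (_ && _).
  case ur' : (u r') => [i'|] //=; apply/eqP/eqP => [[hi]|[->] //].
  by rewrite (h_inj ur' ur hi).
rewrite -[RHS](card_in_image (f := h)); last first.
  move=> i i'; rewrite !inE => /(lt_le_trans s0)/ex[r ur] /(lt_le_trans s0)/ex[r' ur'].
  exact: (h_inj ur ur').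
apply: eq_card => b; apply/idP/fintype.imageP => [|[i + ->]]; rewrite !inE /=.
  move=> sb; have : (0 < count_upto (fun s => omap h (u s)) t b)%N.
    by rewrite -(ltr_nat R); exact: lt_le_trans sb.
  move=> /card_gt0P[r]; rewrite !inE => /andP[_].
  case ur : (u r) => [i|] //= /eqP[hib]; exists i; last by rewrite hib.
  by rewrite inE -(cE _ _ ur) hib.
by move=> si; have [r ur] := ex _ (lt_le_trans s0 si); rewrite (cE _ _ ur).
Qed.

(** Both sources of an entry overshoot by at most [1 / (1 - z)]: a fired bucket run certifies a
    large frequency, and a fired level run passing the rank test certifies more than [r] elements at
    its level. *)
Lemma ge_count_estimate_le (s : R) : 0 < s ->
  (ge_count (estimate o t) s <= ge_count f ((1 - z) * s))%N.
Proof.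
have z0' := z0; have z1' := z1.
move=> s0; have zs0 : 0 < (1 - z) * s by apply: mulr_gt0 => //; lra.
rewrite -[leqRHS](card_ord_lt (ge_count_le f _)).
apply: subset_leq_card; apply/fintype.subsetP => r; rewrite !inE.
move=> /(estimate_ge o t r s0)[[j rj sj]|[l [j [olj rj sl]]]].
  apply: leq_trans rj _; rewrite -bucket_count //.
  apply: subset_leq_card; apply/fintype.subsetP => b; rewrite !inE => /fired_ge.
  by apply: le_trans; rewrite ler_pM2l; [exact: sj|lra].
have := lt_le_trans rj (fired_ge olj); rewrite /= ltr_nat => /leq_trans; apply.
rewrite -ge_count_freq; apply: ge_count_anti; apply: le_trans sl.
by rewrite ger_pMl //; lra.
Qed.

Lemma freq_leT i : f ord0 i <= T%:R.
Proof. by rewrite freqE ler_nat count_upto_le. Qed.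

(** A threshold between [s / (1 + z) ^+ 2] and [s / (1 + z)] has fired for every bucket with count
    at least [s]: one factor is the noise allowance, the other the rounding to the grid. *)
Lemma ge_count_top (s : R) : (1 + z) * b1 <= s \/ (1 <= s /\ b1 = 1) ->
  (ge_count f s <= ge_count (estimate o t) (s / (1 + z) ^+ 2))%N.
Proof.
have z0' := z0; have z1' := z1; have b1' := b1_ge1.
move=> sb; have s1 : 1 <= s.
  by case: sb => [|[]//]; apply: le_trans; rewrite -[leLHS]mulr1 ler_pM //; lra.
have s0 : 0 < s by lra.
have z2 : 0 < (1 + z) ^+ 2 by rewrite exprn_gt0 //; lra.
case: (posnP (ge_count f s)) => [->//|].
move=> /card_gt0P[i]; rewrite inE => si; have sT := le_trans si (freq_leT i).
apply: le_ge_count => [|r rc]; first exact: ge_count_le.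
apply/(estimate_ge o t r); first exact: divr_gt0.
left; have J0 : (0 < J)%N.
  by case: (J) TJ => [|//]; rewrite expr0 => T1; have := le_lt_trans sT T1; lra.
have fire (j : 'I_J) : (forall b, s <= (query h u (inl b) t)%:R -> o (inl b, j, t)) ->
    (r < num_fired o t j)%N.
  move=> so; apply: leq_trans rc _; rewrite -bucket_count //.
  by apply: subset_leq_card; apply/fintype.subsetP => b; rewrite !inE => /so.
case: (lerP ((1 + z) * b1) s) => [bs|sb'].
  have /(power_bracket bs)[j lej ltj] : s < (1 + z) * b1 * (1 + z) ^+ J.
    apply: le_lt_trans sT _; apply: lt_le_trans TJ _; rewrite ler_peMl //.
      by rewrite exprn_ge0 //; lra.
    by rewrite -[leLHS]mulr1 ler_pM //; lra.
  exists j.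
    apply: fire => b sq; apply: contraTT sq => /unfired_lt; rewrite -ltNge /threshold /=.
    by move=> /lt_le_trans; apply; rewrite mulrA.
  rewrite ler_pdivrMr // (le_trans (ltW ltj)) // exprS expr2.
  by rewrite le_eqVlt; apply/orP; left; apply/eqP; ring.
case: sb => [|[_ b1E]]; first by rewrite leNgt sb'.
(* With [b1 = 1] and [s < 1 + z] the lowest threshold 1 works, since its noise is zero. *)
exists (Ordinal J0).
  apply: fire => b sq; apply: contraTT sq => /unfired_lt_small.
  rewrite -ltNge /threshold /= expr0 mulr1 b1E mulr1.
  by move=> lt; apply: lt_le_trans (lt _) s1; lra.
rewrite expr0 mulr1 ler_pdivrMr // b1E mul1r.
have : s < 1 + z by move: sb'; rewrite b1E mulr1.
by rewrite expr2; nra.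
Qed.

(** Besides rounding [s] down to a level, the counts themselves lose a factor: [(1 + z) ^+ 2] for
    noise and grid, [1 - z] for the safety margin in [estimate]. *)
Lemma ge_count_level (l : 'I_m) (s : R) :
  (1 + z) ^+ l <= s -> s < (1 + z) ^+ l.+1 -> (0 < ge_count f s)%N ->
  (1 + z) * b2 <= (ge_count f s)%:R \/ b2 = 1 ->
  (1 - z) / (1 + z) ^+ 2 * (ge_count f s)%:R <=
    (ge_count (estimate o t) (s / (1 + z) ^+ 2))%:R.
Proof.
have z0' := z0; have z1' := z1; have b2' := b2_ge1.
move=> ls sl c0 cb.
have l1 : 1 <= (1 + z) ^+ l by apply: exprn_ege1; lra.
have z2 : 0 < (1 + z) ^+ 2 by rewrite exprn_gt0 //; lra.
set c := ge_count f s in c0 cb *.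
set c' := ge_count f ((1 + z) ^+ l).
have cc' : (c <= c')%N by exact: ge_count_anti.
have cc'R : c%:R <= c'%:R :> R by rewrite ler_nat.
have c'E : c' = query h u (inr l) t by rewrite /c' ge_count_freq.
have c'T : c'%:R <= T%:R :> R by rewrite ler_nat c'E /= level_count_le //; lra.
have c'1 : 1 <= c'%:R :> R by rewrite ler1n (leq_trans c0).
have J0 : (0 < J)%N.
  by case: (J) TJ => [|//]; rewrite expr0 => T1; have := le_lt_trans c'T T1; lra.
have [j oj c'j] : exists2 j : 'I_J, o (inr l, j, t) &
    c'%:R <= (1 + z) ^+ 2 * (b2 * (1 + z) ^+ j).
  case: (lerP ((1 + z) * b2) c'%:R) => [bc|cb'].
    have /(power_bracket bc)[j lej ltj] : c'%:R < (1 + z) * b2 * (1 + z) ^+ J.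
      apply: le_lt_trans c'T _; apply: lt_le_trans TJ _; rewrite ler_peMl //.
        by rewrite exprn_ge0 //; lra.
      by rewrite -[leLHS]mulr1 ler_pM //; lra.
    exists j.
      apply/negPn/negP => /unfired_lt; rewrite -c'E /threshold /= mulrA.
      by rewrite ltNge lej.
    apply: le_trans (ltW ltj) _; rewrite exprS expr2.
    by rewrite le_eqVlt; apply/orP; left; apply/eqP; ring.
  have b2E : b2 = 1 by case: cb => // /le_trans/(_ cc'R); rewrite leNgt cb'.
  exists (Ordinal J0).
    apply/negPn/negP => /unfired_lt_small; rewrite -c'E /threshold /= expr0 mulr1 b2E mulr1.
    by move=> lt; have : c'%:R < 1 :> R by [apply: lt; lra]; lra.
  by rewrite expr0 mulr1 (le_trans (ltW cb')) // ler_pM2r ?expr2; nra.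
set v := (1 - z) * (b2 * (1 + z) ^+ j).
have vc' : v <= c'%:R by rewrite c'E; exact: (fired_ge oj).
have v0 : 0 <= v.
  by apply: mulr_ge0; [lra|apply: mulr_ge0; [lra|apply: exprn_ge0; lra]].
apply: (@le_trans _ _ v).
  rewrite /v mulrAC ler_pdivrMr // -mulrA; apply: ler_wpM2l; first by lra.
  by rewrite (le_trans cc'R) // (le_trans c'j) // mulrC.
(* [k] is the ceiling of [v], so exactly the ranks below [k] pass the test against [v]. *)
have [k [kv vk]] : exists k : nat, (forall r : nat, (r < k)%N -> r%:R < v) /\ v <= k%:R.
  have ex : exists k : nat, v <= k%:R by exists (Num.bound v); exact/ltW/archi_boundP.
  case: (ex_minnP ex) => k vk kmin; exists k; split=> // r.
  by rewrite ltNge; apply: contraTN => /kmin; rewrite leqNgt.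
have kn : (k <= n)%N.
  rewrite leqNgt; apply/negP => /kv; apply/negP; rewrite -leNgt.
  by rewrite (le_trans vc') // ler_nat ge_count_le.
apply: le_trans vk _; rewrite ler_nat; apply: le_ge_count => // r /kv rv.
apply/(estimate_ge o t r); first by apply: divr_gt0 => //; lra.
right; exists l, j; split => //.
rewrite ler_pdivrMr // (le_trans (ltW sl)) // exprSr expr2.
by rewrite ler_pM2l; [nra|lra].
Qed.

End Estimator.

Lemma exists_nat_ceil (R : realType) (x : R) : 0 <= x -> exists k : nat, x <= k%:R /\ k%:R <= x + 1.
Proof.
move=> x0; have ex : exists k : nat, x <= k%:R.
  by exists (Num.bound x); exact/ltW/archi_boundP.
case: (ex_minnP ex) => k xk kmin; exists k; split=> //.
case: k xk kmin => [|k] _ kmin; first by rewrite addr_ge0.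
by rewrite -natr1 lerD2r leNgt; apply/negP => /ltW/kmin; rewrite ltnn.
Qed.

(** * The mechanism: privacy and failure probability *)

Section Mechanism.
Context {R : realType} {n T N m J : nat} (X : nat).
Variables (z b1 b2 H : R).
Hypotheses (z0 : 0 < z) (z1 : z <= 1 / 32) (b1_ge1 : 1 <= b1) (b2_ge1 : 1 <= b2) (H0 : 0 <= H).
Hypotheses (TJ : T%:R < (1 + z) ^+ J).

Notation run := ('I_N.+1 + 'I_m)%type.
Notation coord := (run * 'I_J * option 'I_T)%type.
Notation noise := {ffun coord -> 'I_(X + T).+1}.
Notation hash := {ffun 'I_n -> 'I_N.+1}.
Notation seed := (hash * noise)%type.
Notation thr := (@threshold R N m J z b1 b2).
Notation basis := (@base R N m b1 b2).

(** Chosen so that the noise exceeds the allowance [z * thr r j] with probability at most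
    [expR (- H)]. *)
Definition rate (r : run) (j : 'I_J) : R := H / (z * thr r j).

Definition hash_pmf : hash -> R := prod_pmf (fun _ _ => N.+1%:R^-1).

Definition noise_pmf : noise -> R := prod_pmf (noise_coord_pmf rate).

Definition seed_pmf (w : seed) : R := hash_pmf w.1 * noise_pmf w.2.

Definition seed_table (u : stream n T) (w : seed) :=
  fired_table thr (query (m := m) z w.1 u) w.2.

Definition mech (u : stream n T) (w : seed) (t : 'I_T) : 'rV[R]_n :=
  estimate z b1 b2 (seed_table u w) t.

Lemma threshold_ge1 r j : 1 <= thr r j.
Proof.
have := z0; rewrite /threshold /base => z0'.
have p1 : 1 <= (1 + z) ^+ j by apply: exprn_ege1; lra.
by case: r => _; rewrite -[leLHS]mulr1 ler_pM.
Qed.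

Lemma rate_ge0 r j : 0 <= rate r j.
Proof.
by rewrite /rate divr_ge0 // mulr_ge0 ?(ltW z0) // (le_trans _ (threshold_ge1 r j)).
Qed.

Lemma unif_ge0 (i : 'I_n) (x : 'I_N.+1) : 0 <= N.+1%:R^-1 :> R.
Proof. by rewrite invr_ge0. Qed.

Lemma unif_sum1 (i : 'I_n) : \sum_(x < N.+1) N.+1%:R^-1 = 1 :> R.
Proof. by rewrite sumr_const card_ord -[LHS]mulr_natl divff // pnatr_eq0. Qed.

Lemma hash_pmf_ge0 h : 0 <= hash_pmf h.
Proof. by apply: prod_pmf_ge0; exact: unif_ge0. Qed.

Lemma noise_pmf_ge0 w : 0 <= noise_pmf w.
Proof. by apply: prod_pmf_ge0; apply: noise_coord_ge0; exact: rate_ge0. Qed.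

Lemma seed_pmf_ge0 w : 0 <= seed_pmf w.
Proof. by rewrite mulr_ge0 ?hash_pmf_ge0 ?noise_pmf_ge0. Qed.

Lemma hash_pmf_sum1 : \sum_h hash_pmf h = 1.
Proof. by apply: prod_pmf_sum1; exact: unif_sum1. Qed.

Lemma noise_pmf_sum1 : \sum_w noise_pmf w = 1.
Proof. by apply: prod_pmf_sum1; exact: noise_coord_sum1. Qed.

Lemma prb_seed (A : pred seed) :
  prb seed_pmf A = \sum_h hash_pmf h * prb noise_pmf [pred w | A (h, w)].
Proof.
under eq_bigr => h _ do rewrite /prb mulr_sumr big_mkcond.
rewrite pair_bigA /prb big_mkcond; apply: eq_bigr => -[h w] _ /=.
by case: ifP.
Qed.

Lemma seed_pmf_sum1 : \sum_w seed_pmf w = 1.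
Proof.
rewrite -[LHS]/(prb seed_pmf xpredT) prb_seed -[RHS]hash_pmf_sum1.
by apply: eq_bigr => h _; rewrite [X in _ * X]noise_pmf_sum1 mulr1.
Qed.

Lemma prb_seed_hash (A : pred hash) : prb seed_pmf [pred w | A w.1] = prb hash_pmf A.
Proof.
rewrite prb_seed [RHS]big_mkcond; apply: eq_bigr => h _.
case: ifP => Ah; rewrite /prb /= Ah; first by rewrite noise_pmf_sum1 mulr1.
by rewrite big_pred0 ?mulr0.
Qed.

Lemma prb_seed_noise (A : pred noise) : prb seed_pmf [pred w | A w.2] = prb noise_pmf A.
Proof.
by rewrite prb_seed -[RHS]mul1r -hash_pmf_sum1 mulr_suml.
Qed.

Lemma geometric_sum_le (k : nat) : \sum_(j < k) (1 + z) ^- j <= 2 / z.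
Proof.
have z0' := z0; have z1' := z1.
have : z * \sum_(j < k) (1 + z) ^- j <= (1 + z) - (1 + z) * (1 + z) ^- k.
  elim: k => [|k IH]; first by rewrite big_ord0 mulr0 expr0 invr1 mulr1 subrr.
  rewrite big_ord_recr /= mulrDr; apply: le_trans (lerD IH (lexx _)) _.
  have zn : 1 + z != 0 by rewrite gt_eqF //; lra.
  have -> : (1 + z) ^- k.+1 = (1 + z)^-1 * (1 + z) ^- k by rewrite exprS invfM.
  by rewrite mulrA divff // mul1r; lra.
have pk : 0 <= (1 + z) ^- k by rewrite invr_ge0 exprn_ge0 //; lra.
rewrite ler_pdivlMr // mulrC => /le_trans; apply.
have : 0 <= (1 + z) * (1 + z) ^- k by rewrite mulr_ge0 //; lra.
by lra.
Qed.

Lemma sum_rate_le r : \sum_j 3 * rate r j <= 6 * H / (z ^+ 2 * basis r).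
Proof.
have bg : 0 < basis r by apply: (@lt_le_trans _ _ 1) => //; case: (r).
rewrite (eq_bigr (fun j : 'I_J => 3 * H / (z * basis r) * (1 + z) ^- j)); last first.
  by move=> j _; rewrite /rate /threshold !invfM; ring.
rewrite -mulr_sumr.
have c0 : 0 <= 3 * H / (z * basis r).
  by rewrite divr_ge0 ?mulr_ge0 // ltW.
apply: le_trans (ler_wpM2l c0 (geometric_sum_le J)) _.
rewrite le_eqVlt; apply/orP; left; apply/eqP; field.
by rewrite !gt_eqF // z0.
Qed.

Lemma query_le h (u : stream n T) r t : (query (m := m) (N := N) z h u r t <= T)%N.
Proof.
case: r => [b|l] /=; first exact: count_upto_le.
by apply: level_count_le; apply: exprn_gt0; have := z0; lra.
Qed.

Lemma query_diff h (u v : stream n T) r t : neighboring u v ->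
  (query (m := m) (N := N) z h u r t <= (query (m := m) z h v r t).+1)%N.
Proof.
move=> /neighboringP uv; case: r => [b|l] /=; last exact: level_count_diff.
apply: count_upto_diff => s s' us us'; apply: uv; [move: us|move: us'];
  by apply: contraNN => /eqP ->.
Qed.

Lemma neighboring_sym (u v : stream n T) : neighboring u v -> neighboring v u.
Proof.
rewrite /neighboring; congr (_ <= _)%N; apply: eq_card => s.
by rewrite !in_set_pred eq_sym.
Qed.

(** The bound is proved conditionally on each hash, whose law is the same for both streams. At most
    two bucket counters and all [m] level counters are affected, each at the cost given by
    [sum_rate_le]. *)
Lemma prb_seed_table_le (eps : R) (u v : stream n T) S :
  12 * H / (z ^+ 2 * b1) + m%:R * (6 * H / (z ^+ 2 * b2)) <= eps ->
  neighboring u v ->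
  prb seed_pmf [pred w | S (seed_table u w)] <=
  expR eps * prb seed_pmf [pred w | S (seed_table v w)].
Proof.
move=> budget uv; rewrite !prb_seed mulr_sumr; apply: ler_sum => h _.
rewrite mulrCA; apply: ler_wpM2l; first exact: hash_pmf_ge0.
pose hu := fun s => omap h (u s); pose hv := fun s => omap h (v s).
pose Aff (r : run) := if r is inl b then differ_at hu hv b else true.
have huv s s' : hu s != hv s -> hu s' != hv s' -> s = s'.
  move=> us us'; apply: (neighboringP uv); [move: us|move: us'];
    by apply: contraNN => /eqP e; rewrite /hu /hv e.
have thr0 r j : 0 <= thr r j by apply: le_trans (threshold_ge1 r j).
have main := @prb_fired_table_le R T J X _ _ _ thr0 rate_ge0 (query z h u) (query z h v) Aff S.
apply: le_trans (main _ _ _ _) _.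
- by move=> r t; exact: query_diff.
- by move=> r t; apply/query_diff/neighboring_sym.
- by move=> r t; exact: query_le.
- by move=> [b|l] //= nd t; exact: count_upto_eq.
apply: ler_wpM2r; first by apply: sumr_ge0 => w _; exact: noise_pmf_ge0.
rewrite ler_expR; apply: le_trans budget.
apply: (@le_trans _ _ (\sum_(r | Aff r) 6 * H / (z ^+ 2 * basis r))).
  by apply: ler_sum => r _; exact: sum_rate_le.
rewrite big_sumType /=; apply: lerD.
  rewrite sumr_const -[leLHS]mulr_natl.
  have -> : 12 * H / (z ^+ 2 * b1) = 2 * (6 * H / (z ^+ 2 * b1)) by ring.
  apply: ler_wpM2r; last by rewrite ler_nat; exact: card_differ_at huv.
  by rewrite divr_ge0 ?mulr_ge0 // ?exprn_ge0 ?(ltW z0) // (le_trans _ b1_ge1).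
by rewrite sumr_const card_ord [leRHS]mulr_natl.
Qed.

Lemma mech_continual (u v : stream n T) (t : 'I_T) :
  (forall s : 'I_T, (s <= t)%N -> u s = v s) -> forall w, mech u w t = mech v w t.
Proof.
move=> uv w; have cu (K : eqType) (f : option 'I_n -> option K) (s : 'I_T) k : (s <= t)%N ->
    count_upto (fun s => f (u s)) s k = count_upto (fun s => f (v s)) s k.
  move=> st; apply: eq_card => r; rewrite !inE; case: (leqP r s) => //= rs.
  by rewrite uv // (leq_trans rs).
have qu r (s : 'I_T) : (s <= t)%N -> query (m := m) z w.1 u r s = query z w.1 v r s.
  move=> st; case: r => [b|l] /=; first exact: (cu _ (omap w.1)).
  apply: eq_card => i; rewrite !inE; congr (_ <= _%:R).
  exact: (cu _ id).
have ou r j : seed_table u w (r, j, t) = seed_table v w (r, j, t).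
  rewrite !ffunE /= /fired; apply: eq_existsb => s.
  by case: (leqP s t) => //= st; rewrite qu.
apply/rowP => r; rewrite !mxE /num_fired.
congr (Num.max _ _).
  by apply: eq_bigl => j; congr (_ < _)%N; apply: eq_card => b; rewrite !inE ou.
by apply: eq_bigl => -[l j]; rewrite ou.
Qed.

Definition good_noise (w : noise) : bool :=
  [forall c : coord, (w c)%:R <= z * thr c.1.1 c.1.2].

Definition collision (u : stream n T) (h : hash) (ss : 'I_T * 'I_T) : bool :=
  if (u ss.1, u ss.2) is (Some i, Some i') then (i != i') && (h i == h i') else false.

Definition good_seed (u : stream n T) (w : seed) : bool :=
  good_noise w.2 && ~~ [exists ss, collision u w.1 ss].

(** Union bound over the coordinates; the geometric tail is evaluated at the least integer above the
    allowance. *)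
Lemma prb_bad_noise :
  prb noise_pmf [pred w | ~~ good_noise w] <= #|{: coord}|%:R * expR (- H).
Proof.
apply: (@le_trans _ _ (\sum_(c : coord) prb noise_pmf
    [pred w : noise | z * thr c.1.1 c.1.2 < (w c)%:R])).
  apply: (prb_union_le (B := fun c : coord => [pred w : noise | z * thr c.1.1 c.1.2 < (w c)%:R])).
    exact: noise_pmf_ge0.
  by move=> w /=; rewrite negb_forall => /existsP[c]; rewrite -ltNge; exists c.
rewrite mulr_natl -sumr_const; apply: ler_sum => -[[r j] ot] _ /=.
have zt0 : 0 < z * thr r j.
  by rewrite mulr_gt0 // (lt_le_trans _ (threshold_ge1 r j)).
rewrite (@prb_prod_coord _ _ _ (noise_coord_pmf rate) _ (r, j, ot)
  [pred x : 'I_(X + T).+1 | z * thr r j < x%:R]); last exact: noise_coord_sum1.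
have ex : exists k : nat, z * thr r j < k%:R.
  by exists (Num.bound (z * thr r j)); apply: archi_boundP; exact: ltW.
case: (ex_minnP ex) => k ltk kmin.
apply: (@le_trans _ _ (\sum_(x : 'I_(X + T).+1 | (k <= x)%N) noise_coord_pmf rate (r, j, ot) x)).
  rewrite /prb big_mkcond [leRHS]big_mkcond; apply: ler_sum => x _ /=.
  case: ifP => [/kmin -> //|_]; case: ifP => // _.
  by apply: noise_coord_ge0; exact: rate_ge0.
apply: le_trans (trunc_geo_tail_le _ (expR_gt0 _) k) _.
rewrite -expRM_natr ler_expR mulNr lerN2 /= /rate mulrAC ler_pdivlMr //.
by apply: ler_wpM2l => //; exact: ltW.
Qed.

(** Union bound over pairs of steps; two distinct elements share a bucket with probability
    [1 / N.+1]. *)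
Lemma prb_collision (u : stream n T) :
  prb hash_pmf [pred h | [exists ss, collision u h ss]] <= (T * T)%:R / N.+1%:R.
Proof.
apply: (@le_trans _ _ (\sum_(ss : 'I_T * 'I_T) prb hash_pmf [pred h | collision u h ss])).
  apply: (prb_union_le (B := fun ss : 'I_T * 'I_T => [pred h : hash | collision u h ss])).
    exact: hash_pmf_ge0.
  by move=> h /= /existsP.
have -> : (T * T)%N = #|{: 'I_T * 'I_T}| by rewrite card_prod card_ord.
rewrite mulr_natl -sumr_const; apply: ler_sum => -[s s'] _; rewrite /collision /=.
case us : (u s) => [i|]; last by rewrite /prb big_pred0 // invr_ge0.
case us' : (u s') => [i'|]; last by rewrite /prb big_pred0 // invr_ge0.
have [->|ii'] := eqVneq i i'; first by rewrite /prb big_pred0 ?invr_ge0 // => h /=; rewrite eqxx.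
rewrite [leLHS](_ : _ = prb hash_pmf [pred h : hash | h i == h i']); last first.
  by apply: eq_bigl => h /=.
rewrite (prb_prod_coord2_eq unif_sum1 ii') sumr_const card_ord -[leLHS]mulr_natl mulrA divff ?mul1r //.
Qed.

Lemma prb_good_seed (u : stream n T) :
  1 - #|{: coord}|%:R * expR (- H) - (T * T)%:R / N.+1%:R <= prb seed_pmf (good_seed u).
Proof.
have total : prb seed_pmf (good_seed u) + prb seed_pmf [pred w | ~~ good_seed u w] = 1.
  by rewrite -seed_pmf_sum1 [RHS](bigID (good_seed u)).
have : prb seed_pmf [pred w | ~~ good_seed u w] <=
    prb seed_pmf [pred w | ~~ good_noise w.2] +
    prb seed_pmf [pred w | [exists ss, collision u w.1 ss]].
  have := prb_union_le (C := bool) (P := seed_pmf) (A := [pred w | ~~ good_seed u w])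
    (B := fun b => if b then [pred w | ~~ good_noise w.2]
                   else [pred w | [exists ss, collision u w.1 ss]]) seed_pmf_ge0.
  rewrite big_bool; apply => w /=; rewrite negb_and negbK => /orP[gn|co].
    by exists true.
  by exists false.
rewrite (prb_seed_noise [pred w | ~~ good_noise w]).
rewrite (prb_seed_hash [pred h | [exists ss, collision u h ss]]).
move: total prb_bad_noise (prb_collision u).
move: (#|_|%:R * _) (_ / _) => ba bb; lra.
Qed.

(** * Accuracy on good seeds *)

Section GoodSeed.
(** Good noise stays below the saturation level [X], so every crossing is a genuine comparison. *)
Hypothesis X_large : forall r j, z * thr r j < X%:R.
Variables (u : stream n T) (w : seed) (t : 'I_T).
Hypothesis gw : good_seed u w.

Notation qr r := (query (m := m) z w.1 u r).

Lemma good_seed_noise c : (w.2 c)%:R <= z * thr c.1.1 c.1.2.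
Proof. by move/andP: gw => [/forallP]. Qed.

Lemma good_seed_inj s s' i i' :
  u s = Some i -> u s' = Some i' -> w.1 i = w.1 i' -> i = i'.
Proof.
move=> us us' hh; apply/eqP; move/andP: gw => [_]; apply: contraNT => ii'.
by apply/existsP; exists (s, s'); rewrite /collision us us' ii' hh eqxx.
Qed.

Lemma query_mono r (s : 'I_T) : (s <= t)%N -> (qr r s <= qr r t)%N.
Proof. by move=> st; case: r => [b|l] /=; [exact: count_upto_mono|exact: level_count_mono]. Qed.

(** A firing at an earlier step still certifies the present query because queries only grow. *)
Lemma good_seed_fired r j : seed_table u w (r, j, t) -> (1 - z) * thr r j <= (qr r t)%:R.
Proof.
rewrite ffunE /= => /existsP[s /andP[st]].
have nu := good_seed_noise (r, j, Some s); rewrite /= in nu.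
rewrite /crosses -(ler_nat R) => /orP[/(lt_le_trans (X_large r j))|].
  by rewrite ltNge nu.
have rho : 0 <= (w.2 (r, j, None))%:R :> R by [].
have qm : (qr r s)%:R <= (qr r t)%:R :> R by rewrite ler_nat query_mono.
by move: qm nu rho; lra.
Qed.

Lemma good_seed_unfired r j : ~~ seed_table u w (r, j, t) ->
  (qr r t)%:R < thr r j + (w.2 (r, j, None))%:R.
Proof.
rewrite ffunE /= negb_exists => /forallP/(_ t); rewrite leqnn /= negb_or => /andP[_].
rewrite -ltNge; apply: le_lt_trans; by rewrite lerDl.
Qed.

Lemma good_seed_unfired_lt r j : ~~ seed_table u w (r, j, t) ->
  (qr r t)%:R < (1 + z) * thr r j.
Proof.
move=> /good_seed_unfired; have := good_seed_noise (r, j, None); rewrite /=; lra.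
Qed.

Lemma good_seed_unfired_lt_small r j : ~~ seed_table u w (r, j, t) ->
  z * thr r j < 1 -> (qr r t)%:R < thr r j.
Proof.
move=> /good_seed_unfired qlt zt.
have := le_lt_trans (good_seed_noise (r, j, None)) zt.
by rewrite (ltr_nat R _ 1) ltnS leqn0 => /eqP rho0; move: qlt; rewrite rho0 addr0.
Qed.

Notation f := (freq R u t).

Lemma freq_ge0 i : 0 <= f ord0 i. Proof. by rewrite freqE. Qed.

Lemma mech_upper L : monotone_symmetric_norm L -> L (mech u w t) <= (1 - z)^-1 * L f.
Proof.
move=> Lmsn; have z0' := z0; have z1' := z1.
apply: norm_le_of_scaled_count => //.
- by rewrite invr_gt0; lra.
- exact: freq_ge0.
- exact: estimate_ge0.
move=> s s0; rewrite invrK [s * _]mulrC.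
exact: (ge_count_estimate_le z0 z1 good_seed_inj good_seed_fired).
Qed.

Lemma ge_count_freq_le1 (s : R) : 0 < s -> s <= 1 -> ge_count f s = ge_count f 1.
Proof.
move=> s0 s1; apply: eq_card => i; rewrite !inE freqE.
apply/idP/idP => [/(lt_le_trans s0)|]; last exact: le_trans.
by rewrite ltr0n ler1n.
Qed.

(** Levels from [K] on are handled by the bucket runs and those in [[1, K)] by the level runs;
    levels below 1 reduce to level 1, frequencies being integers. The condition on [p] turns the
    loss in the counts into the ratio [p / p.+1]. *)
Lemma mech_lower L (p A : nat) (K : R) : monotone_symmetric_norm L ->
  (b1 = 1 /\ K = 1) \/ K = (1 + z) * b1 -> K <= (1 + z) ^+ m ->
  (b2 = 1 /\ A = 0%N) \/ (1 + z) * b2 <= A%:R ->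
  p%:R * (1 + z) ^+ 2 <= p.+1%:R * (1 - z) ->
  p%:R * L f <= p.+1%:R * ((1 + z) ^+ 2 * L (mech u w t)) + p%:R * (A%:R * K * L (e1 R n)).
Proof.
move=> Lmsn HK Km HA Hp; have z0' := z0; have z1' := z1; have b1' := b1_ge1.
have c0 : 0 < (1 + z) ^+ 2 by rewrite exprn_gt0 //; lra.
have K1 : 1 <= K by case: HK => [[_ ->]//|->]; nra.
have top := ge_count_top z0 z1 b1_ge1 TJ good_seed_inj good_seed_unfired_lt
  good_seed_unfired_lt_small.
have anti s : s <= 1 -> (ge_count (mech u w t) (1 / (1 + z) ^+ 2) <=
    ge_count (mech u w t) (s / (1 + z) ^+ 2))%N.
  by move=> s1; apply: ge_count_anti; rewrite ler_pM2r // invr_gt0.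
apply: norm_le_of_approx_count => //.
- lra.
- exact: freq_ge0.
- exact: estimate_ge0.
- move=> s Ks; apply: top; case: HK => [[b1E KE]|KE]; first by right; split=> //; lra.
  by left; rewrite -KE.
have mid s : 1 <= s -> s < K -> (ge_count f s < A)%N \/
    (p * ge_count f s <= p.+1 * ge_count (mech u w t) (s / (1 + z) ^+ 2))%N.
  move=> s1 sK; case: (posnP (ge_count f s)) => [->|cpos]; first by right; rewrite muln0.
  have /(power_bracket s1)[l] : s < 1 * (1 + z) ^+ m by rewrite mul1r; exact: lt_le_trans Km.
  rewrite !mul1r => ls sl.
  case: (ltnP (ge_count f s) A) => [cA|Ac]; [by left|right].
  have cb : (1 + z) * b2 <= (ge_count f s)%:R \/ b2 = 1.
    by case: HA => [[-> _]|/le_trans h]; [right|left; apply: h; rewrite ler_nat].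
  have := ge_count_level z0 z1 b2_ge1 TJ good_seed_fired good_seed_unfired_lt
    good_seed_unfired_lt_small ls sl cpos cb.
  rewrite -/(mech u w t) -(ler_nat R) !natrM mulrAC ler_pdivrMr //.
  set e := (ge_count (mech u w t) _)%:R; set c := (ge_count f s)%:R => ce.
  have cz : 0 <= c by [].
  have h1 := ler_wpM2r cz Hp.
  have h2 : p.+1%:R * ((1 - z) * c) <= p.+1%:R * (e * (1 + z) ^+ 2) by rewrite ler_pM2l.
  rewrite -(ler_pM2r c0).
  have -> : p%:R * c * (1 + z) ^+ 2 = p%:R * (1 + z) ^+ 2 * c by ring.
  apply: le_trans h1 _; rewrite -!mulrA; exact: h2.
move=> s s0 sK; case: (lerP 1 s) => [s1|/ltW s1]; first exact: mid.
rewrite (ge_count_freq_le1 s0 s1); case: HK => [[b1E KE]|KE].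
  right; apply: leq_mul => //; apply: leq_trans (anti s s1).
  by apply: top; right.
have K1' : 1 < K by rewrite KE; nra.
case: (mid 1 (lexx 1) K1') => [|le]; [by left|right].
by apply: leq_trans le _; rewrite leq_pmul2l // anti.
Qed.

Lemma mech_accurate L (A : nat) (K alpha : R) : monotone_symmetric_norm L ->
  (b1 = 1 /\ K = 1) \/ K = (1 + z) * b1 -> K <= (1 + z) ^+ m ->
  (b2 = 1 /\ A = 0%N) \/ (1 + z) * b2 <= A%:R -> A%:R * K <= alpha ->
  (1 + 16 * z)^-1 * L f - alpha * L (e1 R n) <= L (mech u w t) /\
  L (mech u w t) <= (1 + 16 * z) * L f + alpha * L (e1 R n).
Proof.
move=> Lmsn HK Km HA AK; have z0' := z0; have z1' := z1.
have [[L0 _ _ _] _ _] := Lmsn.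
have Lf0 := L0 f; have LE0 := L0 (mech u w t); have Le0 := L0 (e1 R n).
have al0 : 0 <= alpha * L (e1 R n).
  apply: mulr_ge0 => //; apply: le_trans AK; apply: mulr_ge0 => //.
  by case: HK => [[_ ->]//|->]; have := b1_ge1; nra.
have zz : 0 < 1 + 16 * z by lra.
(* [p] is about [1 / (4 * z)]: small enough that the counts lose no more than [p / p.+1], large
   enough that [p.+1 / p] times [(1 + z) ^+ 2] stays below [1 + 16 * z]. *)
have [p [pge ple]] : exists p : nat, 1 / (4 * z) - 1 <= p%:R /\ p%:R <= 1 / (4 * z) - 1 + 1.
  by apply: exists_nat_ceil; rewrite subr_ge0 ler_pdivlMr ?mulr_gt0 //; lra.
have pz_le : p%:R * z <= 1 / 4.
  have := ler_wpM2r (ltW z0) ple; rewrite subrK.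
  by rewrite (_ : 1 / (4 * z) * z = 1 / 4) //; field; rewrite gt_eqF.
have pz_ge : 1 / 4 - z <= p%:R * z.
  have := ler_wpM2r (ltW z0) pge.
  by rewrite (_ : (1 / (4 * z) - 1) * z = 1 / 4 - z) //; field; rewrite gt_eqF.
have pcount : p%:R * (1 + z) ^+ 2 <= p.+1%:R * (1 - z).
  by rewrite -natr1 expr2; nra.
have p0 : 0 < p%:R :> R by rewrite -(pmulr_lgt0 _ z0); lra.
have pnorm : p.+1%:R * (1 + z) ^+ 2 <= (1 + 16 * z) * p%:R.
  by rewrite -natr1 expr2; nra.
split.
  have low := mech_lower Lmsn HK Km HA pcount.
  have bound : L f <= (1 + 16 * z) * L (mech u w t) + alpha * L (e1 R n).
    rewrite -(ler_pM2l p0); apply: le_trans low _; rewrite mulrDr; apply: lerD.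
      rewrite mulrA; apply: le_trans (ler_wpM2r LE0 pnorm) _.
      by rewrite [leRHS]mulrA (mulrC p%:R).
    by rewrite ler_pM2l //; apply: ler_wpM2r.
  rewrite lerBlDr ler_pdivrMl // mulrDr; apply: le_trans bound _; rewrite lerD2l.
  by rewrite ler_peMl //; lra.
apply: (@le_trans _ _ ((1 + 16 * z) * L f)); last by rewrite lerDl.
apply: le_trans (mech_upper Lmsn) _; apply: ler_wpM2r => //.
rewrite -[leLHS]mul1r ler_pdivrMr; last lra.
by nra.
Qed.

End GoodSeed.

End Mechanism.

(** * Choice of the parameters *)

Section ParameterChoice.
Context {R : realType}.

(** Gives both the number of levels and the number of thresholds. The clause for [K = 1] leaves no
    level runs when the bucket runs already resolve every positive frequency. *)
Lemma exists_power_cover (z K : R) : 0 < z -> z <= 1 -> 1 <= K ->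
  exists m : nat, [/\ K <= (1 + z) ^+ m, m%:R <= 2 / z * ln K + 1 & K = 1 -> m = 0%N].
Proof.
move=> z0 z1 K1; have K0 : 0 < K by lra.
have lnK0 : 0 <= ln K by rewrite ln_ge0.
have r0 : 0 <= 2 / z * ln K by rewrite mulr_ge0 // divr_ge0 // ltW.
have ex : exists k : nat, 2 / z * ln K <= k%:R.
  by exists (Num.bound (2 / z * ln K)); exact/ltW/archi_boundP.
case: (ex_minnP ex) => m lem mmin; exists m; split.
(* This combines [1 - z / 2 <= expR (- (z / 2))] with [1 <= (1 + z) * (1 - z / 2)]. *)
- have e1 : expR (z / 2) <= 1 + z.
    have := expR_ge1Dx (- (z / 2)); rewrite expRN => h.
    have p0 := expR_gt0 (z / 2).
    have : (1 + - (z / 2)) * expR (z / 2) <= 1.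
      by rewrite -ler_pdivlMr // mul1r.
    move: p0; set e := expR _ => p0 le1; nra.
  rewrite -{1}(lnK K0); apply: le_trans (lerXn2r m _ _ e1); rewrite ?nnegrE ?expR_ge0 //; last lra.
  rewrite -expRM_natr ler_expR.
  have := lem; rewrite mulrAC ler_pdivrMr // => lem'; lra.
- case: m lem mmin => [|m] lem mmin; first lra.
  rewrite -natr1 lerD2r leNgt; apply/negP => /ltW/mmin; by rewrite ltnn.
- move=> KE; apply/eqP; rewrite -leqn0; apply: mmin; by rewrite KE ln1 mulr0.
Qed.

Lemma pow2_le_expR (k : nat) : 2 ^+ k <= expR k%:R :> R.
Proof.
have e2 : 2 <= expR 1 :> R by have := @expR_ge1Dx R 1; lra.
by rewrite -[k%:R]mul1r expRM_natr; apply: lerXn2r; rewrite ?nnegrE ?expR_ge0.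
Qed.

Lemma le_expR_id (x : R) : x <= expR x.
Proof. by have := expR_ge1Dx x; lra. Qed.

(** The 6 is 3 from rounding up to [A] times 2 from [K <= 2 * K1]. The parentheses are the constants
    of [K1] and of the bound on [K2]: 16 from [H], 256 from [z ^- 2], 257 from the bound on [m]. *)
Definition additive_const : R := 6 * (24 * 16 * 256) * (12 * 257 * 16 * 256).

(** Serves to show [ln K <= 8 * Lam], which makes the number of levels [O(Lam / zeta)]. The constant
    is below [2 ^+ 18], and 18 is absorbed by [4 <= Lam]. *)
Lemma log_start_le (eps zeta l ll le lz Lam : R) :
  0 < eps -> 0 < zeta -> 1 <= l -> 4 <= Lam -> 1 <= ll -> 1 <= le -> ll + le + lz <= Lam ->
  l <= expR ll -> eps^-1 <= expR le -> zeta^-1 <= expR lz ->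
  48 * 16 * 256 * (l * Lam * (zeta^-1 * zeta^-1) * eps^-1) <= expR (8 * Lam).
Proof.
move=> e0 t0 l1 L4 ll1 le1 lL lll el zl.
have c : 48 * 16 * 256 <= expR 18%:R :> R by apply: le_trans (pow2_le_expR 18); lra.
have iz0 : 0 <= zeta^-1 by rewrite invr_ge0 ltW.
have ie0 : 0 <= eps^-1 by rewrite invr_ge0 ltW.
apply: (@le_trans _ _ (expR 18%:R * (expR ll * expR Lam * (expR lz * expR lz) * expR le))).
  have L0 : 0 <= Lam by lra.
  have l0 : 0 <= l by lra.
  have lL' : l * Lam <= expR ll * expR Lam by apply: ler_pM => //; exact: le_expR_id.
  have zz : zeta^-1 * zeta^-1 <= expR lz * expR lz by apply: ler_pM.
  have lLzz : l * Lam * (zeta^-1 * zeta^-1) <= expR ll * expR Lam * (expR lz * expR lz).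
    by apply: ler_pM => //; rewrite mulr_ge0.
  by apply: ler_pM => //; [rewrite !mulr_ge0|apply: ler_pM => //; rewrite !mulr_ge0].
by rewrite -!expRD ler_expR; lra.
Qed.

(** The number of noise coordinates is polynomial in [expR l] and [expR Lam], which
    [H = 16 * (l * Lam)] outweighs in the union bound. *)
Lemma coord_count_le (zeta l lz Lam : R) (T m J : nat) :
  0 < zeta -> 1 <= l -> 4 <= Lam -> lz <= Lam -> T%:R <= expR l -> zeta^-1 <= expR lz ->
  m%:R <= 257 * Lam / zeta -> J%:R <= 2 / (zeta / 16) * ln (T%:R + 1) + 1 ->
  (((10 * T * T).+1 + m) * J * T.+1)%:R * expR (- (16 * (l * Lam))) <= 1 / 10.
Proof.
move=> t0 l1 L4 lzL Tl zl mle Jle.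
set a := expR l in Tl *; pose g := expR Lam.
have a1 : 1 <= a by apply: le_trans (expR_ge1Dx _); lra.
have g1 : 1 <= g by apply: le_trans (expR_ge1Dx _); lra.
have zg : zeta^-1 <= g by apply: le_trans zl _; rewrite ler_expR.
have Lg : Lam <= g by exact: le_expR_id.
have iz0 : 0 <= zeta^-1 by rewrite invr_ge0 ltW.
have T0 : 0 <= T%:R :> R by [].
have mg : m%:R <= 257 * (g * g).
  apply: le_trans mle _; rewrite -mulrA ler_pM2l //; apply: ler_pM => //.
  exact: le_trans L4.
have Jg : J%:R <= 33 * (g * a).
  have lnT : ln (T%:R + 1) <= T%:R :> R by rewrite addrC; apply: le_ln1Dx; lra.
  have -> : 33 * (g * a) = 32 * (g * a) + g * a by ring.
  apply: le_trans Jle _; apply: lerD; last by rewrite -[leLHS]mulr1 ler_pM.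
  have -> : 2 / (zeta / 16) = 32 * zeta^-1 by field; rewrite gt_eqF.
  rewrite -mulrA ler_pM2l //; apply: ler_pM => //; last exact: le_trans lnT Tl.
  by rewrite ln_ge0 // lerDr.
have Ng : ((10 * T * T).+1 + m)%:R <= 268 * (a * a * (g * g)).
  have TT : T%:R * T%:R <= a * a by apply: ler_pM.
  have aa : 1 <= a * a by rewrite -[leLHS]mulr1 ler_pM.
  have gg : 1 <= g * g by rewrite -[leLHS]mulr1 ler_pM.
  rewrite natrD -natr1 !natrM; nra.
have Tg : T.+1%:R <= 2 * a by rewrite -natr1; lra.
have prod : (((10 * T * T).+1 + m) * J * T.+1)%:R <=
    268 * (a * a * (g * g)) * (33 * (g * a)) * (2 * a).
  by rewrite natrM natrM; do ![apply: ler_pM | by [] | apply: mulr_ge0].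
have lL : Lam <= l * Lam by rewrite ler_peMl //; lra.
have ll : 4 * l <= l * Lam by rewrite mulrC ler_pM2l //; lra.
have big : expR 18%:R * (a * a * a * a * (g * g * g)) <= expR (16 * (l * Lam)).
  by rewrite -!expRD ler_expR; lra.
have c : 10 * 268 * 33 * 2 <= expR 18%:R :> R by apply: le_trans (pow2_le_expR 18); lra.
have ag : 0 <= a * a * a * a * (g * g * g).
  by rewrite !mulr_ge0 // /a /g expR_ge0.
have := ler_wpM2r ag c.
have -> : 10 * 268 * 33 * 2 * (a * a * a * a * (g * g * g)) =
    10 * (268 * (a * a * (g * g)) * (33 * (g * a)) * (2 * a)) by ring.
move=> h; rewrite expRN ler_pdivrMr ?expR_gt0 //.
by move: prod h big; lra.
Qed.

Lemma exists_parameters (eps zeta l ll le lz Lam : R) (T : nat) :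
  0 < eps -> 0 < zeta -> zeta <= 1 / 2 -> 1 <= l -> 1 <= ll -> 1 <= le -> 1 <= lz ->
  4 <= Lam -> ll + le + lz <= Lam ->
  T%:R <= expR l -> l <= expR ll -> eps^-1 <= expR le -> zeta^-1 <= expR lz ->
  let z := zeta / 16 in
  exists (b1 b2 K H : R) (m J A : nat),
  [/\ [/\ 1 <= b1, 1 <= b2, 0 <= H & T%:R < (1 + z) ^+ J],
      12 * H / (z ^+ 2 * b1) + m%:R * (6 * H / (z ^+ 2 * b2)) <= eps,
      (((10 * T * T).+1 + m) * J * T.+1)%:R * expR (- H) <= 1 / 10,
      [/\ (b1 = 1 /\ K = 1) \/ K = (1 + z) * b1, K <= (1 + z) ^+ m
        & (b2 = 1 /\ A = 0%N) \/ (1 + z) * b2 <= A%:R]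
    & A%:R * K <= additive_const * (l ^+ 2 * Lam ^+ 3 / (eps ^+ 2 * zeta ^+ 5))].
Proof.
move=> e0 t0 t1 l1 ll1 le1 lz1 L4 lL Tl lll el zl z.
have z0 : 0 < z by rewrite /z; lra.
have z1 : z <= 1 / 32 by rewrite /z; lra.
have L0 : 0 < Lam by lra.
have l0 : 0 < l by lra.
pose H := 16 * (l * Lam); have H0 : 0 < H by rewrite /H !mulr_gt0.
have ze0 : 0 < z ^+ 2 * eps by rewrite mulr_gt0 // exprn_gt0.
(* With base at least [K1] the two affected buckets spend at most [eps / 2]; [K2] below does the
   same for the [m] level counters. *)
pose K1 := 24 * H / (z ^+ 2 * eps).
have K10 : 0 < K1 by rewrite /K1 divr_gt0 // mulr_gt0.
pose b1 := Num.max 1 K1.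
(* [K] is the frequency from which the bucket runs take over. *)
pose K := if K1 <= 1 then 1 else (1 + z) * K1.
have Kge1 : 1 <= K by rewrite /K; case: (lerP K1 1) => // ?; nra.
have Kle : K <= Num.max 1 (2 * K1).
  by rewrite /K le_max; case: (lerP K1 1) => ?; apply/orP; [left|right; nra].
have lnKle : ln K <= 8 * Lam.
  have big : 2 * K1 <= expR (8 * Lam).
    have -> : 2 * K1 = 48 * 16 * 256 * (l * Lam * (zeta^-1 * zeta^-1) * eps^-1).
      by rewrite /K1 /H /z; field; rewrite !gt_eqF.
    exact: (log_start_le e0 t0 l1 L4 ll1 le1 lL).
  rewrite -(expRK (8 * Lam)) ler_ln ?posrE ?expR_gt0 //; last by lra.
  apply: le_trans Kle _; rewrite ge_max big andbT.
  by apply: le_trans (expR_ge1Dx _); lra.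
have zle1 : z <= 1 by lra.
have [m [Km mle m0]] := exists_power_cover z0 zle1 Kge1.
have T1 : 1 <= T%:R + 1 :> R by rewrite lerDr ler0n.
have [J [TJ Jle _]] := exists_power_cover z0 zle1 T1.
pose K2 := 12 * m%:R * H / (z ^+ 2 * eps).
have K20 : 0 <= K2 by rewrite /K2 divr_ge0 ?mulr_ge0 // ltW.
pose b2 := Num.max 1 K2.
have [A' [A'ge A'le]] : exists k : nat, (1 + z) * K2 <= k%:R /\ k%:R <= (1 + z) * K2 + 1.
  by apply: exists_nat_ceil; apply: mulr_ge0 => //; lra.
(* With [b2 = 1] the level counts have only relative error from the first element on, so nothing is
   charged additively. *)
pose A := if K2 <= 1 then 0%N else A'.
have mle' : m%:R <= 257 * Lam / zeta.
  have i1 : 1 <= zeta^-1 by rewrite -[leLHS]invr1 lef_pV2 ?posrE //; lra.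
  have i0 : 0 <= zeta^-1 by lra.
  have Lz : 1 <= Lam * zeta^-1 by rewrite -[leLHS]mulr1 ler_pM //; lra.
  have -> : 257 * Lam / zeta = 32 * zeta^-1 * (8 * Lam) + Lam * zeta^-1 by ring.
  apply: le_trans mle _; apply: lerD => //.
  have -> : 2 / z = 32 * zeta^-1 by rewrite /z; field; rewrite gt_eqF.
  by rewrite ler_wpM2l // mulr_ge0.
have b1K : K1 <= b1 by rewrite le_max lexx orbT.
have b2K : K2 <= b2 by rewrite le_max lexx orbT.
have b10 : 0 < b1 by apply: lt_le_trans b1K.
have b20 : 0 < b2 by rewrite lt_max ltr01.
exists b1, b2, K, H, m, J, A; split.
- split; rewrite ?le_max ?lexx ?(ltW H0) //.
  by apply: lt_le_trans TJ; rewrite ltrDl.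
- have zz : 0 < z ^+ 2 by rewrite exprn_gt0.
  have h1 : 12 * H / (z ^+ 2 * b1) <= eps / 2.
    rewrite ler_pdivrMr ?mulr_gt0 //.
    have : K1 * (z ^+ 2 * eps) <= b1 * (z ^+ 2 * eps) by rewrite ler_pM2r.
    rewrite /K1 divfK ?gt_eqF //.
    have -> : eps / 2 * (z ^+ 2 * b1) = b1 * (z ^+ 2 * eps) / 2 by field.
    by lra.
  have h2 : m%:R * (6 * H / (z ^+ 2 * b2)) <= eps / 2.
    rewrite mulrA ler_pdivrMr ?mulr_gt0 //.
    have : K2 * (z ^+ 2 * eps) <= b2 * (z ^+ 2 * eps) by rewrite ler_pM2r.
    rewrite /K2 divfK ?gt_eqF //.
    have -> : eps / 2 * (z ^+ 2 * b2) = b2 * (z ^+ 2 * eps) / 2 by field.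
    have -> : 12 * m%:R * H = 2 * (m%:R * (6 * H)) by ring.
    by lra.
  by lra.
- by apply: (coord_count_le t0 l1 L4 _ Tl zl mle' Jle); lra.
- split=> //.
    by rewrite /K /b1; case: (lerP K1 1) => h; [left|right].
  by rewrite /A /b2; case: (lerP K2 1) => h; [left|right].
have C0 : 0 <= additive_const * (l ^+ 2 * Lam ^+ 3 / (eps ^+ 2 * zeta ^+ 5)).
  apply: mulr_ge0; first by rewrite /additive_const; lra.
  by rewrite divr_ge0 // ltW // mulr_gt0 // exprn_gt0.
rewrite /A; case: (lerP K2 1) => [_|K2gt]; first by rewrite mul0r.
(* If [K1 <= 1] then [K = 1], hence [m = 0] and [K2 = 0]. *)
have K1gt : 1 < K1.
  rewrite ltNge; apply/negP => K1le; move: K2gt.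
  by rewrite /K2 m0 ?mulr0 ?mul0r ?ltr10 // /K K1le.
have Kle2 : K <= 2 * K1 by rewrite /K ifN -?ltNge //; nra.
have A3 : A'%:R <= 3 * K2 by apply: le_trans A'le _; nra.
have iz0 : 0 <= zeta^-1 by rewrite invr_ge0 ltW.
have K2le : K2 <= 12 * (257 * Lam / zeta) * H / (z ^+ 2 * eps).
  by rewrite ler_pM2r ?invr_gt0 // ler_pM2r // ler_pM2l.
apply: (@le_trans _ _ (3 * (12 * (257 * Lam / zeta) * H / (z ^+ 2 * eps)) * (2 * K1))).
  apply: ler_pM => //; first by lra.
  by apply: le_trans A3 _; rewrite ler_pM2l.
rewrite le_eqVlt; apply/orP; left; apply/eqP.
rewrite /K1 /H /z /additive_const; field.
by rewrite !gt_eqF.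
Qed.

End ParameterChoice.

(** * Assembly of the theorem *)

Lemma le_expR_lg (R : realType) (x : R) : x <= expR (lg x).
Proof.
have [x0|x0] := ltrP 0 x; last by apply: le_trans x0 _; exact: expR_ge0.
by rewrite -{1}(lnK x0) ler_expR le_max lexx orbT.
Qed.

Lemma lg_ge1 (R : realType) (x : R) : 1 <= lg x.
Proof. by rewrite le_max lexx. Qed.

Lemma lg_natM_ge (R : realType) (n T : nat) : (0 < n)%N -> lg (T%:R : R) <= lg ((n * T)%:R : R).
Proof.
move=> n0; case: T => [|T]; first by rewrite muln0.
have TnT : (T.+1 <= n * T.+1)%N by rewrite leq_pmull.
rewrite /lg ge_max le_max lexx /= le_max; apply/orP; right.
by rewrite ler_ln ?posrE ?ltr0n ?muln_gt0 ?n0 // ler_nat.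
Qed.

Theorem mainTheorem19 (R : realType) :
  exists (C : R) (k : nat),
  forall (eps delta zeta : R) (n T : nat),
    0 < eps -> 0 < delta -> 0 < zeta -> zeta <= 1 / 2 -> (0 < n)%N ->
    let alpha : R :=
      C * (lg (T%:R) ^+ 2 * Num.sqrt (lg (T%:R)) * Num.sqrt (lg ((n * T)%:R))
           * lg (1 / delta) / (eps ^+ 2 * zeta ^+ 5))
        * (lg (lg ((n * T)%:R)) + lg (lg (1 / delta)) + lg (1 / eps) + lg (1 / zeta)) ^+ k
    in
    exists (d : measure_display) (Omega : measurableType d) (P : probability Omega R)
           (M : mechanism R Omega n T),
      [/\ mech_measurable M,
          continual M,
          eps_delta_DP P M eps delta
        & forall (u : stream n T) (t : 'I_T),
          exists A : set Omega,
            [/\ measurable A, ((2 / 3)%:E <= P A)%E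
              & forall w, A w ->
                  forall L : 'rV[R]_n -> R, monotone_symmetric_norm L ->
                    (1 + zeta)^-1 * L (freq R u t) - alpha * L (e1 R n) <= L (M u w t)
                    /\ L (M u w t) <= (1 + zeta) * L (freq R u t) + alpha * L (e1 R n)]].
Proof.
(* The exponent 3 comes from one [Lam] in each of the two bases through [H], and one in the number
   of levels. *)
exists (@additive_const R), 3%N => eps delta zeta n T e0 d0 t0 t1 n0 alpha.
pose l : R := lg T%:R; pose ll : R := lg (lg (n * T)%:R).
pose le := lg (1 / eps); pose lz := lg (1 / zeta).
pose Lam := ll + lg (lg (1 / delta)) + le + lz.
have l1 : 1 <= l by exact: lg_ge1.
have ll1 : 1 <= ll by exact: lg_ge1.
have le1 : 1 <= le by exact: lg_ge1.
have lz1 : 1 <= lz by exact: lg_ge1.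
have ld1 : 1 <= lg (lg (1 / delta)) by exact: lg_ge1.
have L4 : 4 <= Lam by rewrite /Lam; lra.
have lL : ll + le + lz <= Lam by rewrite /Lam; lra.
have lll : l <= expR ll by apply: le_trans (le_expR_lg _); exact: lg_natM_ge.
have el : eps^-1 <= expR le by have := le_expR_lg (1 / eps); rewrite {1}div1r.
have zl : zeta^-1 <= expR lz by have := le_expR_lg (1 / zeta); rewrite {1}div1r.
have alphaE : additive_const * (l ^+ 2 * Lam ^+ 3 / (eps ^+ 2 * zeta ^+ 5)) <= alpha.
  have L3 : 0 <= Lam ^+ 3 by rewrite exprn_ge0 //; lra.
  have iv : 0 <= (eps ^+ 2 * zeta ^+ 5)^-1 by rewrite invr_ge0 mulr_ge0 // exprn_ge0 // ltW.
  rewrite /alpha -/l -/ll -/le -/lz -/Lam -[leRHS]mulrA.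
  apply: ler_wpM2l; first by rewrite /additive_const; lra.
  rewrite [leLHS]mulrAC; apply: ler_wpM2r => //; apply: ler_wpM2r => //.
  (* The remaining factors of [alpha], two square roots and [lg (1 / delta)], are all at least 1. *)
  have sq x : 1 <= x -> 1 <= Num.sqrt x :> R by move=> x1; rewrite -sqrtr1 ler_sqrt //; lra.
  have l2 : 0 <= l ^+ 2 by rewrite exprn_ge0 //; lra.
  rewrite -!(mulrA (l ^+ 2)); apply: ler_peMr => //.
  have ge1M x y : 1 <= x -> 1 <= y -> 1 <= x * y :> R.
    by move=> x1 y1; rewrite -[leLHS]mulr1; apply: ler_pM.
  by apply: (ge1M _ _ (ge1M _ _ (sq _ l1) (sq _ (lg_ge1 _))) (lg_ge1 _)).
have := exists_parameters e0 t0 t1 l1 ll1 le1 lz1 L4 lL (le_expR_lg _) lll el zl.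
set z := zeta / 16.
move=> [b1 [b2 [K [H [m [J [A [[b11 b21 H0 TJ] budget coordH [HK Km HA] AK]]]]]]]].
have z0 : 0 < z by rewrite /z; lra.
have z1 : z <= 1 / 32 by rewrite /z; lra.
pose N := (10 * T * T)%N.
(* [X] exceeds every noise allowance [z * threshold]. *)
pose X := Num.bound (z * ((b1 + b2) * (1 + z) ^+ J)).
have X_large (r : 'I_N.+1 + 'I_m) (j : 'I_J) : z * threshold z b1 b2 r j < X%:R.
  apply: (@le_lt_trans _ _ (z * ((b1 + b2) * (1 + z) ^+ J))); last first.
    by apply: archi_boundP; rewrite !mulr_ge0 ?exprn_ge0 //; lra.
  rewrite ler_pM2l // /threshold ler_pM //.
  - by rewrite /base; case: r => _; lra.
  - by rewrite exprn_ge0 //; lra.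
  - by rewrite /base; case: r => _; lra.
  - by apply: ler_weXn2l; [lra|exact: ltnW].
pose w0 : {ffun 'I_n -> 'I_N.+1} *
    {ffun ('I_N.+1 + 'I_m) * 'I_J * option 'I_T -> 'I_(X + T).+1} :=
  ([ffun=> ord0], [ffun=> ord0]).
have [P [f Pf]] := fin_probability_exists (seed_pmf_ge0 (n := n) (X := X) z0 b11 b21 H0)
  (seed_pmf_sum1 _ _ _ _ _) w0.
pose M : mechanism R nat n T := fun u k => mech z b1 b2 u (f k).
exists _, nat, P, M; split.
- by move=> u S _.
- by move=> u v t uv k; exact: mech_continual.
- move=> u v uv S _.
  (* The output is a deterministic function of the table, so privacy of the table passes to it. *)
  pose S' : pred {ffun (('I_N.+1 + 'I_m) * 'I_J * 'I_T) -> bool} :=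
    [pred o | `[< S (estimate z b1 b2 o) >]].
  have ME w : M w @^-1` S = [set k | S' (seed_table z b1 b2 w (f k))].
    by apply/seteqP; split => k /=; [move=> /asboolP|move=> /asboolP].
  rewrite !ME (Pf [pred s | S' (seed_table z b1 b2 u s)]).
  rewrite (Pf [pred s | S' (seed_table z b1 b2 v s)]) -EFinM -EFinD lee_fin.
  apply: le_trans (prb_seed_table_le X z0 z1 b11 b21 H0 S' budget uv) _.
  by rewrite lerDl ltW.
move=> u t; exists [set k | good_seed z b1 b2 u (f k)]; split => //.
  (* Bad noise and hash collisions each have probability at most 1/10, leaving more than 2/3. *)
  rewrite (Pf (good_seed z b1 b2 u)) lee_fin.
  apply: le_trans (prb_good_seed X z0 b11 b21 H0 u).
  rewrite !card_prod card_sum card_option !card_ord.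
  have : (T * T)%:R / N.+1%:R <= 1 / 10 :> R.
    rewrite ler_pdivrMr ?ltr0n // -[N.+1%:R]natr1 /N !natrM; lra.
  by move: coordH; rewrite -/N; move: (_ * expR _) (_ / N.+1%:R) => x y; lra.
move=> k gk L Lmsn; rewrite (_ : zeta = 16 * z); last by rewrite /z mulrC divfK.
exact: (mech_accurate z0 z1 b11 b21 TJ X_large t gk Lmsn HK Km HA (le_trans AK alphaE)).
Qed.
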